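(* For every $p>1$, the functional \[L(f)=\int_{1/2}^\infty\big(f(s)-a_1\big)\,ds,\qquad f(s)=\sum_{n\ge1}a_nn^{-s},\] (integration along the real half-line $[1/2,\infty)$), defined on Dirichlet polynomials, satisfies $|L(f)|\le C_p\|f\|_{\mathcal{H}^p}$ for some constant $C_p$, i.e. $L$ extends to a bounded linear functional on $\mathcal{H}^p$.
   Context: For $1\le p<\infty$, $\mathcal{H}^p$ is the completion of Dirichlet polynomials $P(s)=\sum_{n\le N}a_nn^{-s}$ in the norm $\|P\|_{\mathcal{H}^p}=\lim_{T\to\infty}(\frac1{2T}\int_{-T}^T|P(it)|^pdt)^{1/p}$; its elements are Dirichlet series converging absolutely in $\{\operatorname{Re}s>1/2\}$. *)

(* Defs.v *)
From Stdlib Require Import Reals.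
From Coquelicot Require Import Coquelicot.
Open Scope R_scope.

(* real power x^y for x >= 0, with the convention 0^y = 0 (y > 0 in all uses) *)
Definition rpow (x y : R) : R :=
  if Req_EM_T x 0 then 0 else Rpower x y.

(* n^{-s} for n >= 1 and complex s = sigma + i t :
   n^{-s} = exp(-s log n) = n^{-sigma} (cos(t log n) - i sin(t log n)) *)
Definition npow_neg (n : nat) (s : C) : C :=
  (exp (- Re s * ln (INR n)) * cos (Im s * ln (INR n)),
   - (exp (- Re s * ln (INR n)) * sin (Im s * ln (INR n))))%R.

Definition dir_poly (N : nat) (a : nat -> C) (s : C) : C :=
  sum_n_m (fun n => Cmult (a n) (npow_neg n s)) 1 N.

Definition Hp_norm (p : R) (N : nat) (a : nat -> C) : R :=
  real (Lim (fun T => rpow (/ (2 * T) *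
            RInt (fun t => rpow (Cmod (dir_poly N a (RtoC 0 + Ci * RtoC t)%C)) p) (- T) T)
            (/ p)) p_infty).

Definition dir_coef (N : nat) (a : nat -> C) (n : nat) : C :=
  if andb (Nat.leb 1 n) (Nat.leb n N) then a n else RtoC 0.

(* Main.v *)
(** Point evaluation at [s] in (1/2, 2] has norm at most a constant times (s - 1/2)^(-g) on
    H^p for some g < 1, so it can be integrated up to the abscissa 1/2; beyond [s = 2] the
    coefficient bound |a_n| <= 3 ||f|| suffices.  The point evaluation bound is a duality
    argument in the style of Cole and Gamelin.  Choose [m] with (p - 1)(2m - 1) >= 1, so that
    [2m] is at least the conjugate exponent of [p], and put b = 1 - 1/m, w_q = q^(-s),
      A(t) = prod_q sum_(k <= K) w_q^k q^(-ikt),    B(t) = prod_q (1 - b w_q q^(-it)),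
    over the primes q <= N.  By unique factorisation the mean of f B conj(A) over the line is
    f(s) prod_q (1 - b w_q^2).  The mean of |B A|^(2m) is prod_q sum_k |h_(q,k)|^2 with h_q
    the coefficients of (1 - b w_q z)^m (sum_k (w_q z)^k)^m; the choice of [b] makes
    h_(q,1) = w_q, so it is at most prod_q (1 + w_q^2 + O(w_q^4)).  Altogether
    |f(s)| <= C ||f|| prod_q (1 + q^(-2s))^(1 - 1/(2m)), and the product is at most zeta(2s). *)
Require Import Defs.
From HB Require Import structures.
From Stdlib Require Import Reals Lra Lia.
From Coquelicot Require Import Coquelicot.
From mathcomp Require Import all_boot.
Open Scope R_scope.

(** * Exponential sums and unique factorisation *)

HB.instance Definition _ := Monoid.isComLaw.Build R 0 Rplus
  (fun x y z => esym (Rplus_assoc x y z)) Rplus_comm Rplus_0_l.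
HB.instance Definition _ := Monoid.isComLaw.Build R 1 Rmult
  (fun x y z => esym (Rmult_assoc x y z)) Rmult_comm Rmult_1_l.
HB.instance Definition _ := Monoid.isMulLaw.Build R 0 Rmult Rmult_0_l Rmult_0_r.
HB.instance Definition _ := Monoid.isAddLaw.Build R Rmult Rplus
  Rmult_plus_distr_r Rmult_plus_distr_l.
HB.instance Definition _ := Monoid.isComLaw.Build C (RtoC 0) Cplus
  Cplus_assoc Cplus_comm Cplus_0_l.
HB.instance Definition _ := Monoid.isComLaw.Build C (RtoC 1) Cmult
  Cmult_assoc Cmult_comm Cmult_1_l.
HB.instance Definition _ := Monoid.isMulLaw.Build C (RtoC 0) Cmult Cmult_0_l Cmult_0_r.
HB.instance Definition _ := Monoid.isAddLaw.Build C Cmult Cplus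
  Cmult_plus_distr_r Cmult_plus_distr_l.

(** Decidable equality makes [R * nat] an [eqType], so that membership of a monomial in a list can
    be stated. *)
Definition R_eqb (x y : R) : bool := if Req_EM_T x y then true else false.

Lemma R_eqP : Equality.axiom R_eqb.
Proof. by move=> x y; rewrite /R_eqb; case: Req_EM_T => h; constructor. Qed.
HB.instance Definition _ := hasDecEq.Build R R_eqP.

Notation "\sum_ ( i <- r ) F" := (\big[Rplus/0]_(i <- r) F) : R_scope.
Notation "\prod_ ( i <- r ) F" := (\big[Rmult/1]_(i <- r) F) : R_scope.
Notation "\sum_ ( i <- r ) F" := (\big[Cplus/RtoC 0]_(i <- r) F%C) : C_scope.
Notation "\prod_ ( i <- r ) F" := (\big[Cmult/RtoC 1]_(i <- r) F%C) : C_scope.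

(* A pair [(c, n)] stands for the monomial with coefficient [c] and frequency [n]:
   [c z^n] when lists are multiplied by [conv addn], [c n^(-it)] when by [conv muln]. *)
Definition conv (op : nat -> nat -> nat) (F G : seq (R * nat)) : seq (R * nat) :=
  [seq (x.1 * y.1, op x.2 y.2) | x <- F, y <- G].

(** The inner product for which distinct frequencies are orthonormal. A list may repeat a frequency,
    hence the comparison of all pairs. *)
Definition dot (F G : seq (R * nat)) : R :=
  \sum_(x <- F) \sum_(y <- G) (if x.2 == y.2 then x.1 * y.1 else 0).

Definition at_prime (q : nat) (h : seq (R * nat)) : seq (R * nat) :=
  [seq (x.1, (q ^ x.2)%N) | x <- h].

(** The expanded product over the primes q in [P] of the polynomials [h q], each evaluated at z =
    q^(-it). *)
Definition euler (h : nat -> seq (R * nat)) (P : seq nat) : seq (R * nat) :=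
  foldr (fun q => conv muln (at_prime q (h q))) [:: (1, 1%N)] P.

Definition posfreq (F : seq (R * nat)) : Prop := forall x : R * nat, x \in F -> (0 < x.2)%N.

Lemma big_conv (A : Type) (idx : A) (add : Monoid.law idx) (f : R * nat -> A) op F G :
  \big[add/idx]_(x <- conv op F G) f x =
  \big[add/idx]_(x <- F) \big[add/idx]_(y <- G) f (x.1 * y.1, op x.2 y.2).
Proof. exact: big_allpairs_dep. Qed.

Lemma posfreq_conv F G : posfreq F -> posfreq G -> posfreq (conv muln F G).
Proof.
move=> hF hG z /allpairsP [[x y] /= [hx hy ->]] /=.
by rewrite muln_gt0 hF // hG.
Qed.

Lemma posfreq_at_prime q h : prime q -> posfreq (at_prime q h).
Proof. by move=> pq z /mapP [x hx ->] /=; rewrite expn_gt0 prime_gt0. Qed.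

Lemma posfreq_euler h P : all prime P -> posfreq (euler h P).
Proof.
elim: P => [_ x|q P IH /= /andP [pq aP]]; first by rewrite inE => /eqP ->.
by apply: posfreq_conv; [exact: posfreq_at_prime | exact: IH].
Qed.

Lemma euler_coprime h P q : all prime P -> prime q -> q \notin P ->
  forall x : R * nat, x \in euler h P -> ~~ (q %| x.2)%N.
Proof.
move=> + pq; elim: P => [_ _ x|r P IH /= /andP [pr aP]].
  by rewrite inE => /eqP -> /=; rewrite dvdn1; case: q pq => [|[|]].
rewrite inE negb_or => /andP [qr qP] z /allpairsP [[x y] /= [hx hy ->]] /=.
rewrite Euclid_dvdM // negb_or (IH _ _ _ hy) // andbT.
case/mapP: hx => e _ -> /=; rewrite Euclid_dvdX // negb_and.
by rewrite dvdn_prime2 // qr.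
Qed.

(** Unique factorisation, one prime at a time: the q-adic valuation recovers the exponent, and the
    power of q then cancels. *)
Lemma expn_mul_coprime_inj q a b n m : prime q -> (0 < n)%N -> (0 < m)%N ->
  ~~ (q %| n)%N -> ~~ (q %| m)%N ->
  (q ^ a * n == q ^ b * m)%N = (a == b) && (n == m).
Proof.
move=> pq n0 m0 qn qm; apply/eqP/andP => [E|[/eqP -> /eqP ->] //].
have q0 k : (0 < q ^ k)%N by rewrite expn_gt0 prime_gt0.
have ab : a = b.
  have := congr1 (logn q) E.
  rewrite !lognM // !pfactorK //.
  by rewrite !logn_coprime ?prime_coprime // !addn0.
move: E; rewrite ab => /eqP; by rewrite eqn_pmul2l.
Qed.

(** Independence of the primes. Frequencies over the remaining primes are coprime to q, so two
    frequencies agree exactly when their q-parts and their cofactors agree, and the double sum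
    splits off the factor at q. *)
Lemma dot_euler h g P : uniq P -> all prime P ->
  dot (euler h P) (euler g P) = \prod_(q <- P) dot (h q) (g q).
Proof.
elim: P => [_ _|q P IH /= /andP [qP uP] /andP [pq aP]].
  by rewrite /dot /= !big_seq1 /= big_nil Rmult_1_r.
rewrite big_cons -IH // /dot big_conv big_map big_distrl /=.
apply: eq_bigr => x _.
rewrite big_distrr /= big_seq [RHS]big_seq; apply: eq_bigr => y hy.
rewrite big_conv big_map big_distrlr; apply: eq_bigr => z _ /=.
rewrite big_seq [RHS]big_seq; apply: eq_bigr => w hw.
rewrite expn_mul_coprime_inj ?(posfreq_euler _ _ aP _ hy) ?(posfreq_euler _ _ aP _ hw) //
  ?(euler_coprime _ _ q aP pq qP _ hy) ?(euler_coprime _ _ q aP pq qP _ hw) //.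
case: eqP => _ /=; last by rewrite Rmult_0_l.
case: eqP => _ /=; last by rewrite Rmult_0_r.
ring.
Qed.

(** This is n^(-it), with the real and imaginary parts written out. *)
Definition chi (n : nat) (t : R) : C :=
  (cos (t * ln (INR n)), - sin (t * ln (INR n))).

Definition Ev (F : seq (R * nat)) (t : R) : C :=
  (\sum_(x <- F) (RtoC x.1 * chi x.2 t))%C.

Lemma INR_gt0 n : (0 < n)%N -> 0 < INR n.
Proof. by move=> /ltP h; apply: lt_0_INR. Qed.

Lemma chi_mul n m t : (0 < n)%N -> (0 < m)%N -> chi (n * m) t = (chi n t * chi m t)%C.
Proof.
move=> /INR_gt0 n0 /INR_gt0 m0; rewrite /chi -multE mult_INR ln_mult //.
rewrite Rmult_plus_distr_l cos_plus sin_plus /Cmult /=; f_equal; ring.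
Qed.

Lemma chi1 t : chi 1 t = RtoC 1.
Proof. by rewrite /chi /= ln_1 Rmult_0_r cos_0 sin_0 Ropp_0. Qed.

Lemma Ev_conv F G t : posfreq F -> posfreq G ->
  Ev (conv muln F G) t = (Ev F t * Ev G t)%C.
Proof.
move=> hF hG; rewrite /Ev big_conv big_distrlr /=.
rewrite big_seq [RHS]big_seq; apply: eq_bigr => x hx.
rewrite big_seq [RHS]big_seq; apply: eq_bigr => y hy.
rewrite /= chi_mul ?(hF _ hx) ?(hG _ hy) // RtoC_mult; ring.
Qed.

Lemma at_prime_conv q h g :
  at_prime q (conv addn h g) = conv muln (at_prime q h) (at_prime q g).
Proof.
rewrite /at_prime /conv map_allpairs allpairs_mapl allpairs_mapr.
by apply: eq_allpairs => x y /=; rewrite expnD.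
Qed.

Lemma Ev_euler h P t : all prime P ->
  Ev (euler h P) t = (\prod_(q <- P) Ev (at_prime q (h q)) t)%C.
Proof.
elim: P => [_|q P IH /= /andP [pq aP]].
  by rewrite /Ev big_seq1 big_nil /= chi1 Cmult_1_l.
rewrite big_cons Ev_conv ?IH //; [exact: posfreq_at_prime|exact: posfreq_euler].
Qed.

(** * Mean values *)

(** Integer half-lengths suffice: the limit [Lim] at [p_infty] in [Hp_norm] is itself taken along
    the sequence [INR k]. *)
Definition avg (g : R -> R) (k : nat) : R := / (2 * INR k) * RInt g (- INR k) (INR k).

(** Continuity is included so that all the integrals exist and averages are additive. *)
Definition has_mean (g : R -> R) (mu : R) : Prop :=
  (forall t, continuous g t) /\ is_lim_seq (avg g) mu.

Lemma ex_RInt_cont (g : R -> R) a b : (forall t, continuous g t) -> ex_RInt g a b.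
Proof. by move=> cg; apply: ex_RInt_continuous => t _; apply: cg. Qed.

Lemma has_mean_ext f g mu : (forall t, f t = g t) -> has_mean f mu -> has_mean g mu.
Proof.
move=> fg [cf lf]; split=> [t|]; first exact: continuous_ext (cf t).
apply: is_lim_seq_ext lf => k; rewrite /avg; congr (_ * _).
by apply: RInt_ext => t _.
Qed.

Lemma has_mean_plus f g mu nu :
  has_mean f mu -> has_mean g nu -> has_mean (fun t => f t + g t) (mu + nu).
Proof.
move=> [cf lf] [cg lg]; split=> [t|]; first exact: (continuous_plus f g).
apply: is_lim_seq_ext (is_lim_seq_plus' _ _ _ _ lf lg) => k; rewrite /avg.
rewrite (RInt_plus f g); [exact: esym (Rmult_plus_distr_l _ _ _)|exact: ex_RInt_cont..].
Qed.

Lemma INR_lim_inv : is_lim_seq (fun k => / INR k) 0.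
Proof. exact: is_lim_seq_inv is_lim_seq_INR _. Qed.

Lemma eventually_INR_gt0 : eventually (fun k => 0 < INR k).
Proof. by exists 1%N => k h; apply: lt_0_INR. Qed.

(** For a nonzero frequency the integral stays bounded, so its average is O(1/k). *)
Lemma has_mean_trig x y th :
  has_mean (fun t => x * cos (t * th) + y * sin (t * th)) (if Req_EM_T th 0 then x else 0).
Proof.
split=> [t|].
  by apply: (ex_derive_continuous (fun t => x * cos (t * th) + y * sin (t * th)) t); auto_derive.
case: Req_EM_T => [h0 | h] /=.
  apply: (is_lim_seq_ext_loc (fun _ => x)); last exact: is_lim_seq_const.
  apply: filter_imp eventually_INR_gt0 => k hk; rewrite /avg.
  rewrite (RInt_ext _ (fun _ => x)).
    by rewrite RInt_const /scal /= /mult /=; field; lra.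
  by move=> t _; rewrite h0 Rmult_0_r cos_0 sin_0 Rmult_1_r Rmult_0_r Rplus_0_r.
(* The sine term is odd and contributes nothing over a symmetric interval. *)
have E k : RInt (fun t => x * cos (t * th) + y * sin (t * th)) (- INR k) (INR k)
   = 2 * (x / th) * sin (INR k * th).
  have := is_RInt_derive (fun t => x / th * sin (t * th) - y / th * cos (t * th))
    (fun t => x * cos (t * th) + y * sin (t * th)) (- INR k) (INR k).
  move=> H; rewrite (is_RInt_unique _ _ _ _ (H _ _)).
  - rewrite /minus /plus /opp /= -!Ropp_mult_distr_l sin_neg cos_neg; ring.
  - by move=> t _; auto_derive => //; field.
  - move=> t _; apply: (ex_derive_continuous (fun t => x * cos (t * th) + y * sin (t * th)) t).
    by auto_derive.
apply: (is_lim_seq_le_le_loc (fun k => - Rabs (x / th) * / INR k) _ (fun k => Rabs (x / th) * / INR k)).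
- apply: filter_imp eventually_INR_gt0 => k hk; rewrite /avg E.
  have -> : / (2 * INR k) * (2 * (x / th) * sin (INR k * th)) =
    (x / th * sin (INR k * th)) * / INR k by field; lra.
  have i0 : 0 < / INR k by apply: Rinv_0_lt_compat.
  have B : Rabs (x / th * sin (INR k * th)) <= Rabs (x / th).
    rewrite Rabs_mult -[X in _ <= X]Rmult_1_r; apply: Rmult_le_compat_l; first exact: Rabs_pos.
    apply/Rabs_le; exact: SIN_bound.
  have := Rabs_le_between _ _ => /(_ (x / th * sin (INR k * th)) (Rabs (x / th))) [/(_ B) [B1 B2] _].
  by split; apply: Rmult_le_compat_r; lra.
- have := is_lim_seq_scal_l _ (- Rabs (x / th)) _ INR_lim_inv.
  by rewrite /= Rmult_0_r.
- have := is_lim_seq_scal_l _ (Rabs (x / th)) _ INR_lim_inv.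
  by rewrite /= Rmult_0_r.
Qed.

Lemma has_mean_zero : has_mean (fun _ => 0) 0.
Proof.
have := has_mean_trig 0 0 0.
have -> : (if Req_EM_T 0 0 then 0 else 0) = 0 by case: Req_EM_T.
by apply: has_mean_ext => t; ring.
Qed.

Lemma has_mean_big (A : eqType) (r : seq A) (g : A -> R -> R) (mu : A -> R) :
  (forall x, x \in r -> has_mean (g x) (mu x)) ->
  has_mean (fun t => \sum_(x <- r) g x t) (\sum_(x <- r) mu x).
Proof.
elim: r => [_|x r IH H].
  by rewrite big_nil; apply: has_mean_ext has_mean_zero => t; rewrite big_nil.
rewrite big_cons; apply: has_mean_ext (has_mean_plus _ _ _ _ (H x _) (IH _)).
- by move=> t; rewrite big_cons.
- exact: mem_head.
- by move=> y hy; apply: H; rewrite inE hy orbT.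
Qed.

Lemma Re_sum (A : Type) (r : seq A) (g : A -> C) :
  Re (\sum_(x <- r) g x)%C = \sum_(x <- r) Re (g x).
Proof. exact: (big_morph Re). Qed.

Lemma Cconj_sum (A : Type) (r : seq A) (g : A -> C) :
  Cconj (\sum_(x <- r) g x)%C = (\sum_(x <- r) Cconj (g x))%C.
Proof.
apply: (big_morph Cconj) => [x y|]; last by rewrite /Cconj /= Ropp_0.
by rewrite /Cconj /Cplus /= Ropp_plus_distr.
Qed.

(** Orthogonality of the characters: the frequency ln n - ln m vanishes only for n = m. Taking real
    parts keeps all integrals real-valued, and [z] carries a complex coefficient. *)
Lemma has_mean_chi (z : C) n m : (0 < n)%N -> (0 < m)%N ->
  has_mean (fun t => Re (z * (chi n t * Cconj (chi m t)))%C) (if n == m then Re z else 0).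
Proof.
move=> n0 m0.
have := has_mean_trig (Re z) (Im z) (ln (INR n) - ln (INR m)).
have -> : (if Req_EM_T (ln (INR n) - ln (INR m)) 0 then Re z else 0) =
  (if n == m then Re z else 0).
  case: Req_EM_T => [h|h]; case: eqP => [e|e] //.
    case: e; apply: INR_eq; apply: ln_inv; try exact: INR_gt0; lra.
  by case: h; rewrite e; ring.
apply: has_mean_ext => t; rewrite Rmult_minus_distr_l cos_minus sin_minus.
rewrite /chi; case: z => u v; rewrite /Cmult /Cconj /=; ring.
Qed.

(** Parseval's identity, by expanding the double sum; the coefficients are real, so conjugation acts
    on the characters only. *)
Lemma has_mean_Ev (z : C) F G : posfreq F -> posfreq G ->
  has_mean (fun t => Re (z * (Ev F t * Cconj (Ev G t)))%C) (Re z * dot F G).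
Proof.
move=> hF hG.
have -> : Re z * dot F G = \sum_(x <- F) \sum_(y <- G)
    (if x.2 == y.2 then Re (z * RtoC (Rmult x.1 y.1))%C else 0).
  rewrite /dot big_distrr /=; apply: eq_bigr => x _; rewrite big_distrr /=.
  apply: eq_bigr => y _; case: eqP => _; last by rewrite Rmult_0_r.
  by case: z => u v; rewrite /=; ring.
apply: (has_mean_ext (fun t => \sum_(x <- F) \sum_(y <- G)
    Re (z * RtoC (Rmult x.1 y.1) * (chi x.2 t * Cconj (chi y.2 t)))%C)).
  move=> t; rewrite /Ev Cconj_sum big_distrlr big_distrr Re_sum.
  apply: eq_bigr => x _; rewrite big_distrr Re_sum; apply: eq_bigr => y _.
  congr Re; change (z * RtoC (Rmult x.1 y.1) * (chi x.2 t * Cconj (chi y.2 t)) =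
    z * (x.1 * chi x.2 t * Cconj (y.1 * chi y.2 t)))%C; rewrite RtoC_mult.
  have -> : Cconj (y.1 * chi y.2 t)%C = (y.1 * Cconj (chi y.2 t))%C.
    by rewrite /Cconj /Cmult /=; f_equal; ring.
  ring.
apply: (has_mean_big _ F) => x hx; apply: (has_mean_big _ G) => y hy.
by apply: has_mean_chi; [exact: hF|exact: hG].
Qed.

(** * Duality for the mean norm *)

Lemma rpow_ge0 x p : 0 <= rpow x p.
Proof. by rewrite /rpow; case: Req_EM_T => _; [lra|apply: Rlt_le; apply: exp_pos]. Qed.

Lemma rpow_pos x p : 0 < x -> rpow x p = exp (p * ln x).
Proof. by move=> h; rewrite /rpow; case: Req_EM_T => // e; lra. Qed.

Lemma rpow_0 p : rpow 0 p = 0.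
Proof. by rewrite /rpow; case: Req_EM_T. Qed.

Lemma exp_le x y : x <= y -> exp x <= exp y.
Proof. by case=> [h|->]; [apply: Rlt_le; apply: exp_increasing|lra]. Qed.

Lemma ln_le x y : 0 < x -> x <= y -> ln x <= ln y.
Proof. by move=> x0; case=> [h|->]; [apply: Rlt_le; apply: ln_increasing|lra]. Qed.

Lemma rpow_le x y p : 0 < p -> 0 <= x <= y -> rpow x p <= rpow y p.
Proof.
move=> p0 [[x0|<-] xy]; last by rewrite rpow_0; apply: rpow_ge0.
rewrite !rpow_pos //; try lra; apply: exp_le; apply: Rmult_le_compat_l; first lra.
exact: ln_le.
Qed.

Lemma rpow_rpow x p q : 0 <= x -> rpow (rpow x p) q = rpow x (p * q).
Proof.
case=> [x0|<-]; last by rewrite !rpow_0.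
by rewrite (rpow_pos x) // rpow_pos ?ln_exp ?(rpow_pos x) //; [congr exp; ring|exact: exp_pos].
Qed.

Lemma rpow_1 x : 0 <= x -> rpow x 1 = x.
Proof. by case=> [x0|<-]; [rewrite rpow_pos // Rmult_1_l exp_ln|rewrite rpow_0]. Qed.

Lemma rpow_div x y p : 0 <= x -> 0 < y -> rpow (x / y) p = rpow x p / rpow y p.
Proof.
case=> [x0|<-] y0; last by rewrite /Rdiv !Rmult_0_l rpow_0 Rmult_0_l.
rewrite !rpow_pos //; last exact: Rdiv_lt_0_compat.
by rewrite ln_div // Rmult_minus_distr_l /Rminus exp_plus exp_Ropp.
Qed.

Lemma continuous_rpow (g : R -> R) p t : 0 < p -> (forall s, 0 <= g s) ->
  continuous g t -> continuous (fun s => rpow (g s) p) t.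
Proof.
move=> p0 g0 cg; case: (g0 t) => gt.
  apply: (continuous_ext_loc _ (fun s => exp (p * ln (g s)))).
    have : locally t (fun s => 0 < g s) by apply: cg; exact: (open_gt 0).
    by apply: filter_imp => s hs; rewrite rpow_pos.
  apply: (continuous_comp g (fun x => exp (p * ln x))) => //.
  by apply: (ex_derive_continuous (fun x => exp (p * ln x))); auto_derive.
apply/filterlim_locally => eps; rewrite -gt rpow_0.
(* At a zero of [g]: the threshold is eps^(1/p), below which the p-th power of [g] is less than
   eps. *)
have d0 : 0 < exp (ln eps / p) by exact: exp_pos.
have : locally t (fun s => g s < exp (ln eps / p)).
  apply: (cg (fun y => y < exp (ln eps / p))).
  by apply: (open_lt (exp (ln eps / p))); rewrite -gt.
apply: filter_imp => s hs; rewrite /ball /= /AbsRing_ball /abs /minus /plus /opp /=.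
rewrite Ropp_0 Rplus_0_r Rabs_pos_eq; last exact: rpow_ge0.
case: (g0 s) => gs; last by rewrite -gs rpow_0; exact: cond_pos.
rewrite rpow_pos // -[X in _ < X](exp_ln eps); last exact: cond_pos.
apply: exp_increasing; apply: (Rmult_lt_reg_l (/ p)); first exact: Rinv_0_lt_compat.
rewrite -Rmult_assoc Rinv_l; last lra.
by rewrite Rmult_1_l Rmult_comm -[X in _ < X]ln_exp; apply: ln_increasing.
Qed.

(** A crude form of Young's inequality with all constants 1. Since 2m is at least the conjugate
    exponent of p, comparing logarithms shows that u v is always at most one of the three terms. *)
Lemma young u v p m : 0 <= u -> 0 <= v -> 1 < p -> 1 <= (p - 1) * (INR (2 * m) - 1) ->
  u * v <= 1 + rpow u p + v ^ (2 * m).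
Proof.
move=> u0 v0 p1 hm.
have P1 := rpow_ge0 u p.
have P2 : 0 <= v ^ (2 * m) by apply: pow_le.
have m1 : 1 < INR (2 * m) by nra.
case: (Req_dec u 0) => [e|un]; first by (have -> : u * v = 0 by rewrite e; ring); lra.
case: (Req_dec v 0) => [e|vn]; first by (have -> : u * v = 0 by rewrite e; ring); lra.
have {}u0 : 0 < u by lra.
have {}v0 : 0 < v by lra.
have vp : v ^ (2 * m) = exp (INR (2 * m) * ln v) by rewrite -Rpower_pow.
have uvE : u * v = exp (ln u + ln v) by rewrite exp_plus !exp_ln.
(* If v <= u^(p-1), then u v <= u^p. Otherwise, for u > 1, the hypothesis on m gives u <= v^(2m-1);
   for u <= 1 the product is at most v, hence at most 1 or v^(2m). *)
case: (Rle_lt_dec (ln v) ((p - 1) * ln u)) => h.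
  suff : u * v <= rpow u p by lra.
  by rewrite uvE rpow_pos //; apply: exp_le; lra.
case: (Rle_lt_dec (ln u) 0) => hu.
  case: (Rle_lt_dec (ln v) 0) => hv.
    suff : u * v <= 1 by lra.
    by rewrite uvE -exp_0; apply: exp_le; lra.
  suff : u * v <= v ^ (2 * m) by lra.
  by rewrite vp uvE; apply: exp_le; nra.
suff : u * v <= v ^ (2 * m) by lra.
rewrite vp uvE; apply: exp_le.
suff : ln u <= (INR (2 * m) - 1) * ln v by lra.
apply: (Rle_trans _ ((INR (2 * m) - 1) * ((p - 1) * ln u))); nra.
Qed.

Lemma avg_le f g k : (forall t, continuous f t) -> (forall t, continuous g t) ->
  0 < INR k -> (forall t, f t <= g t) -> avg f k <= avg g k.
Proof.
move=> cf cg hk h; apply: Rmult_le_compat_l; first by apply: Rlt_le; apply: Rinv_0_lt_compat; lra.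
by apply: RInt_le => //; try exact: ex_RInt_cont; lra.
Qed.

Lemma avg_const c k : 0 < INR k -> avg (fun _ => c) k = c.
Proof. by move=> hk; rewrite /avg RInt_const /scal /= /mult /=; field; lra. Qed.

Lemma avg_plus f g k : (forall t, continuous f t) -> (forall t, continuous g t) ->
  avg (fun t => f t + g t) k = avg f k + avg g k.
Proof.
move=> cf cg; rewrite /avg (RInt_plus f g); try exact: ex_RInt_cont.
exact: Rmult_plus_distr_l.
Qed.

Lemma avg_scal c f k : (forall t, continuous f t) ->
  avg (fun t => c * f t) k = c * avg f k.
Proof.
move=> cf; rewrite /avg (RInt_scal f); last exact: ex_RInt_cont.
rewrite /scal /= /mult /=; ring.
Qed.

Lemma continuous_scalR c (f : R -> R) t : continuous f t -> continuous (fun s => c * f s) t.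
Proof. exact: (continuous_scal_r c f). Qed.

Definition trunc_norm (p : R) (f : R -> C) (k : nat) : R :=
  rpow (avg (fun t => rpow (Cmod (f t)) p) k) (/ p).

(** A Hölder-type inequality: [young] is applied to |f|/X and |G|/Y and averaged, with X essentially
    the truncated norm of f. The three terms then contribute 1, at most 1, and the normalised mean
    of |G|^(2m). *)
Lemma trunc_norm_duality p m (f G : R -> C) c Y k : 1 < p ->
  1 <= (p - 1) * (INR (2 * m) - 1) -> 0 < INR k -> 0 < Y -> Cmod c <= 1 ->
  (forall t, continuous (fun t => Cmod (f t)) t) ->
  (forall t, continuous (fun t => Cmod (G t) ^ (2 * m)) t) ->
  (forall t, continuous (fun t => Re (c * (f t * G t))%C) t) ->
  avg (fun t => Re (c * (f t * G t))%C) k <=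
  trunc_norm p f k * (Y * (2 + avg (fun t => Cmod (G t) ^ (2 * m)) k / Y ^ (2 * m))).
Proof.
move=> p1 hm hk Y0 hc cf cG cfG.
have cfp t : continuous (fun t => rpow (Cmod (f t)) p) t.
  by apply: continuous_rpow => //; [lra|move=> s; exact: Cmod_ge_0].
set A := avg (fun t => rpow (Cmod (f t)) p) k.
set B := avg (fun t => Cmod (G t) ^ (2 * m)) k.
have A0 : 0 <= A.
  rewrite -(avg_const 0 k hk); apply: avg_le => // [t|t]; last exact: rpow_ge0.
  exact: continuous_const.
have B0 : 0 <= B.
  rewrite -(avg_const 0 k hk); apply: avg_le => // [t|t].
    exact: continuous_const.
  by apply: pow_le; exact: Cmod_ge_0.
have Ym : 0 < Y ^ (2 * m) by exact: pow_lt.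
set Z := Y * _.
have Z0 : 0 < Z.
  apply: Rmult_lt_0_compat => //.
  have : 0 <= B / Y ^ (2 * m) by apply: Rmult_le_pos => //; apply: Rlt_le; exact: Rinv_0_lt_compat.
  lra.
have X0 : 0 <= trunc_norm p f k by exact: rpow_ge0.
apply: le_epsilon => eps e0.
(* The truncated norm may be zero, so it is enlarged slightly before dividing by it; the increment
   is chosen to cost exactly [eps] in the conclusion. *)
set X := trunc_norm p f k + eps / Z.
have eZ : 0 < eps / Z by exact: Rdiv_lt_0_compat.
have Xp : 0 < X by rewrite /X; lra.
have -> : trunc_norm p f k * Z + eps = X * Z by rewrite /X; field; lra.
have AX : A <= rpow X p.
  have -> : A = rpow (trunc_norm p f k) p.
    by rewrite /trunc_norm rpow_rpow // Rinv_l ?rpow_1 //; lra.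
  by apply: rpow_le; rewrite /X; lra.
have rX : 0 < rpow X p by rewrite rpow_pos //; exact: exp_pos.
apply: (Rle_trans _ (avg (fun t => X * Y + (X * Y / rpow X p * rpow (Cmod (f t)) p
   + X * Y / Y ^ (2 * m) * Cmod (G t) ^ (2 * m))) k)).
  apply: avg_le => // t.
    apply: (continuous_plus (fun _ => X * Y)); first exact: continuous_const.
    by apply: (continuous_plus (fun t => X * Y / rpow X p * rpow (Cmod (f t)) p));
      apply: continuous_scalR.
  apply: (Rle_trans _ (Cmod (f t) * Cmod (G t))).
    apply: Rle_trans (Rle_abs _) _; apply: Rle_trans (Rmax_l _ _) _.
    apply: Rle_trans (Rmax_Cmod _) _; rewrite !Cmod_mult.
    rewrite -[X in _ <= X]Rmult_1_l; apply: Rmult_le_compat_r => //.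
    by apply: Rmult_le_pos; exact: Cmod_ge_0.
  have := young (Cmod (f t) / X) (Cmod (G t) / Y) p m.
  rewrite rpow_div; [|exact: Cmod_ge_0|done].
  have -> : (Cmod (G t) / Y) ^ (2 * m) = Cmod (G t) ^ (2 * m) / Y ^ (2 * m).
    by rewrite /Rdiv Rpow_mult_distr pow_inv.
  move=> H.
  have -> : Cmod (f t) * Cmod (G t) = X * Y * (Cmod (f t) / X * (Cmod (G t) / Y)) by field; lra.
  apply: (Rle_trans _ (X * Y * (1 + rpow (Cmod (f t)) p / rpow X p + Cmod (G t) ^ (2 * m) / Y ^ (2 * m)))).
    apply: Rmult_le_compat_l; first by apply: Rmult_le_pos; lra.
    by apply: H => //; apply: Rmult_le_pos; try exact: Cmod_ge_0;
      apply: Rlt_le; apply: Rinv_0_lt_compat.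
  by apply: Req_le; field; split; lra.
rewrite (avg_plus (fun _ => X * Y)); first last.
- move=> t; apply: (continuous_plus (fun t => X * Y / rpow X p * rpow (Cmod (f t)) p));
  exact: continuous_scalR.
- by move=> t; exact: continuous_const.
rewrite avg_const // avg_plus; try by move=> t; exact: continuous_scalR.
rewrite !avg_scal // -/A -/B /Z.
have : X * Y / rpow X p * A <= X * Y.
  have -> : X * Y / rpow X p * A = X * Y * (A / rpow X p) by field; lra.
  rewrite -[X in _ <= X]Rmult_1_r; apply: Rmult_le_compat_l; first by apply: Rmult_le_pos; lra.
  by apply/Rle_div_l; lra.
have -> : X * Y / Y ^ (2 * m) * B = X * Y * (B / Y ^ (2 * m)) by field; lra.
lra.
Qed.

(* [Lim_seq] is the average of the upper and lower limits, so a lower bound for the truncated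
   norms passes to it without convergence; [M] is there because [real p_infty = 0]. *)
Lemma norm_duality p m (f G : R -> C) c Y M mu nu : 1 < p ->
  1 <= (p - 1) * (INR (2 * m) - 1) -> 0 < Y -> Cmod c <= 1 ->
  (forall t, continuous (fun t => Cmod (f t)) t) -> (forall t, Cmod (f t) <= M) ->
  has_mean (fun t => Cmod (G t) ^ (2 * m)) mu -> mu <= Y ^ (2 * m) ->
  has_mean (fun t => Re (c * (f t * G t))%C) nu ->
  nu <= 3 * Y * real (Lim_seq (trunc_norm p f)).
Proof.
move=> p1 hm Y0 hc cf fM [cG lG] muY [cfG lfG].
have Ym : 0 < Y ^ (2 * m) by exact: pow_lt.
have mu0 : 0 <= mu.
  apply: (is_lim_seq_le_loc (fun _ => 0) _ 0 mu _ (is_lim_seq_const 0) lG).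
  apply: filter_imp eventually_INR_gt0 => k hk.
  rewrite -(avg_const 0 k hk); apply: avg_le => // [t|t].
    exact: continuous_const.
  by apply: pow_le; exact: Cmod_ge_0.
set Z := Y * (2 + mu / Y ^ (2 * m)).
have q0 : 0 <= mu / Y ^ (2 * m).
  by apply: Rmult_le_pos => //; apply: Rlt_le; exact: Rinv_0_lt_compat.
have q1 : mu / Y ^ (2 * m) <= 1 by apply/Rle_div_l; lra.
have Z0 : 0 < Z by apply: Rmult_lt_0_compat => //; lra.
pose Zk k := Y * (2 + avg (fun t => Cmod (G t) ^ (2 * m)) k / Y ^ (2 * m)).
have lZ : is_lim_seq Zk Z.
  apply: (is_lim_seq_scal_l _ Y (2 + mu / Y ^ (2 * m))).
  apply: is_lim_seq_plus'; first exact: is_lim_seq_const.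
  exact: (is_lim_seq_scal_r _ (/ Y ^ (2 * m)) mu lG).
have lq : is_lim_seq (fun k => avg (fun t => Re (c * (f t * G t))%C) k / Zk k) (nu / Z).
  by apply: is_lim_seq_div' => //; lra.
have M0 : 0 <= M by apply: Rle_trans (Cmod_ge_0 (f 0)) (fM 0).
have up : Rbar_le (Lim_seq (trunc_norm p f)) M.
  rewrite -(Lim_seq_const M); apply: Lim_seq_le_loc.
  apply: filter_imp eventually_INR_gt0 => k hk.
  have cfp t : continuous (fun t => rpow (Cmod (f t)) p) t.
    by apply: continuous_rpow => //; [lra|move=> s; exact: Cmod_ge_0].
  have -> : M = rpow (rpow M p) (/ p) by rewrite rpow_rpow // Rinv_r ?rpow_1 //; lra.
  apply: rpow_le; first by apply: Rinv_0_lt_compat; lra.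
  split.
    rewrite -(avg_const 0 k hk); apply: avg_le => // [t|t]; last exact: rpow_ge0.
    exact: continuous_const.
  rewrite -(avg_const (rpow M p) k hk); apply: avg_le => // [t|t].
    exact: continuous_const.
  by apply: rpow_le; [lra|split; [exact: Cmod_ge_0|]].
have lo : Rbar_le (nu / Z) (Lim_seq (trunc_norm p f)).
  rewrite -(is_lim_seq_unique _ _ lq); apply: Lim_seq_le_loc.
  have ev : eventually (fun k => 0 < Zk k) by apply: lZ; exact: (open_gt 0).
  apply: filter_imp (filter_and _ _ eventually_INR_gt0 ev) => k [hk hz].
  by apply/Rle_div_l => //; exact: trunc_norm_duality.
have nn : Rbar_le 0 (Lim_seq (trunc_norm p f)).
  by rewrite -(Lim_seq_const 0); apply: Lim_seq_le_loc; exists 0%N => k _; exact: rpow_ge0.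
move: up lo nn; case: Lim_seq => [H|//|//] /= _ lo nn.
have {}lo : nu <= H * Z by apply/Rle_div_l.
apply: Rle_trans lo _; rewrite Rmult_comm; apply: Rmult_le_compat_r => //.
(* The ratio [mu / Y ^ (2 * m)] is at most 1, so [Z] is at most [3 * Y]. *)
rewrite /Z Rmult_comm; apply: Rmult_le_compat_r; lra.
Qed.

(** * Coefficients of one Euler factor *)

Definition geom (w : R) (K : nat) : seq (R * nat) := [seq (w ^ k, k) | k <- iota 0 K.+1].
Definition lin (b : R) : seq (R * nat) := [:: (1, 0%N); (- b, 1%N)].
Definition polyexp (F : seq (R * nat)) (m : nat) : seq (R * nat) :=
  iter m (conv addn F) [:: (1, 0%N)].
Definition coef (F : seq (R * nat)) (k : nat) : R :=
  \sum_(x <- F) (if x.2 == k then x.1 else 0).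
(** The absolute coefficient sum on the circle of radius r. It is multiplicative under [conv addn]
    at the level of lists and serves as the majorant in Cauchy's estimate. *)
Definition weight (r : R) (F : seq (R * nat)) : R := \sum_(x <- F) (Rabs x.1 * r ^ x.2).

Lemma sum_le (A : eqType) (r : seq A) (f g : A -> R) :
  (forall x, x \in r -> f x <= g x) -> \sum_(x <- r) f x <= \sum_(x <- r) g x.
Proof.
move=> H; rewrite big_seq [X in _ <= X]big_seq.
by apply: (big_ind2 Rle) => //; [lra|move=> *; lra].
Qed.

Lemma sum_ge0 (A : eqType) (r : seq A) (f : A -> R) :
  (forall x, x \in r -> 0 <= f x) -> 0 <= \sum_(x <- r) f x.
Proof. by move=> H; apply: Rle_trans (sum_le _ _ _ _ H); rewrite big1 //; lra. Qed.

Lemma prod_le (A : eqType) (r : seq A) (f g : A -> R) :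
  (forall x, x \in r -> 0 <= f x <= g x) ->
  0 <= \prod_(x <- r) f x <= \prod_(x <- r) g x.
Proof.
move=> H; rewrite big_seq [X in _ <= _ <= X]big_seq.
apply: (big_ind2 (fun a b => 0 <= a <= b)) => //; first lra.
by move=> a b c d h1 h2; split; [apply: Rmult_le_pos; lra|apply: Rmult_le_compat; lra].
Qed.

Lemma sum_delta (v : nat) (f : nat -> R) (r : seq nat) : uniq r ->
  \sum_(k <- r) (if v == k then f k else 0) = if v \in r then f v else 0.
Proof.
move=> ur; case: ifP => hv.
  rewrite (bigD1_seq v) //= eqxx big1 ?Rplus_0_r // => k /negbTE.
  by rewrite eq_sym => ->.
rewrite big_seq big1 // => k hk; case: eqP => // e.
by rewrite e hk in hv.
Qed.

Lemma coef_conv0 F G : coef (conv addn F G) 0 = coef F 0 * coef G 0.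
Proof.
rewrite /coef big_conv big_distrlr; apply: eq_bigr => x _; apply: eq_bigr => y _.
rewrite /= addn_eq0; case: eqP => _ /=; last by rewrite Rmult_0_l.
by case: eqP => _; rewrite ?Rmult_0_r.
Qed.

Lemma coef_conv1 F G :
  coef (conv addn F G) 1 = coef F 0 * coef G 1 + coef F 1 * coef G 0.
Proof.
rewrite /coef big_conv !big_distrlr -big_split; apply: eq_bigr => x _.
rewrite -big_split; apply: eq_bigr => y _ /=.
by case: x.2 => [|[|?]]; case: y.2 => [|[|?]] /=; ring.
Qed.

Lemma coef_polyexp0 F m : coef F 0 = 1 -> coef (polyexp F m) 0 = 1.
Proof.
move=> h; elim: m => [|m IH]; first by rewrite /coef big_seq1.
by rewrite [polyexp _ _]/= coef_conv0 h IH Rmult_1_l.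
Qed.

Lemma coef_polyexp1 F m : coef F 0 = 1 -> coef (polyexp F m) 1 = INR m * coef F 1.
Proof.
move=> h; elim: m => [|m IH]; first by rewrite /coef big_seq1 /= Rmult_0_l.
by rewrite [polyexp _ _]/= coef_conv1 h IH (coef_polyexp0 _ m h) S_INR; ring.
Qed.

Lemma weight_conv r F G : weight r (conv addn F G) = weight r F * weight r G.
Proof.
rewrite /weight big_conv big_distrlr; apply: eq_bigr => x _; apply: eq_bigr => y _ /=.
by rewrite Rabs_mult -plusE pow_add; ring.
Qed.

Lemma weight_polyexp r F m : weight r (polyexp F m) = weight r F ^ m.
Proof.
elim: m => [|m IH]; first by rewrite /weight big_seq1 /= Rabs_R1; ring.
by rewrite [polyexp _ _]/= weight_conv IH.
Qed.

Lemma weight_ge0 r F : 0 <= r -> 0 <= weight r F.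
Proof.
by move=> h; apply: sum_ge0 => x _; apply: Rmult_le_pos; [exact: Rabs_pos|exact: pow_le].
Qed.

(** Cauchy's estimate: each entry of frequency k already contributes its absolute value times r^k to
    the weight. *)
Lemma coef_weight r F k : 0 < r -> Rabs (coef F k) <= weight r F / r ^ k.
Proof.
move=> r0; have rk := pow_lt r k r0.
apply/Rle_div_r => //; rewrite /coef /weight; elim: F => [|x F IH].
  by rewrite !big_nil Rabs_R0; lra.
rewrite !big_cons; apply: Rle_trans (Rmult_le_compat_r _ _ _ _ (Rabs_triang _ _)) _; first lra.
rewrite Rmult_plus_distr_r; apply: Rplus_le_compat => //; case: eqP => [<-|_]; first lra.
rewrite Rabs_R0 Rmult_0_l; apply: Rmult_le_pos; [exact: Rabs_pos|apply: pow_le; lra].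
Qed.

Lemma sum_by_coef F D (c : nat -> R) : (forall x : R * nat, x \in F -> (x.2 <= D)%N) ->
  \sum_(x <- F) (x.1 * c x.2) = \sum_(k <- iota 0 D.+1) (coef F k * c k).
Proof.
move=> hD; under [RHS]eq_bigr => k _ do rewrite /coef big_distrl.
rewrite exchange_big big_seq [RHS]big_seq; apply: eq_bigr => x hx /=.
rewrite -[LHS]/(((fun k => x.1 * c k)) x.2).
have := sum_delta x.2 (fun k => x.1 * c k) (iota 0 D.+1) (iota_uniq _ _).
rewrite mem_iota /= add0n ltnS (hD _ hx) => <-; apply: eq_bigr => k _.
by case: eqP => _; rewrite ?Rmult_0_l.
Qed.

Lemma dot_by_coef F D : (forall x : R * nat, x \in F -> (x.2 <= D)%N) ->
  dot F F = \sum_(k <- iota 0 D.+1) (coef F k * coef F k).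
Proof.
move=> hD; rewrite -sum_by_coef // /dot; apply: eq_bigr => x _.
rewrite /coef big_distrr; apply: eq_bigr => y _ /=.
by rewrite eq_sym; case: eqP => _; rewrite ?Rmult_0_r.
Qed.

Lemma geometric_sum_le x a n : 0 <= x < 1 -> \sum_(k <- iota a n) (x ^ k) <= x ^ a / (1 - x).
Proof.
move=> hx; elim: n a => [|n IH] a.
  rewrite big_nil; apply: Rmult_le_pos; first by apply: pow_le; lra.
  by apply: Rlt_le; apply: Rinv_0_lt_compat; lra.
rewrite [iota _ _]/= big_cons; apply: Rle_trans (Rplus_le_compat_l _ _ _ (IH _)) _.
by apply: Req_le; rewrite /=; field; lra.
Qed.

Lemma degree_bound (F : seq (R * nat)) : exists D, forall x : R * nat, x \in F -> (x.2 <= D)%N.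
Proof.
elim: F => [|y F [D hD]]; first by exists 0%N.
exists (maxn y.2 D) => x; rewrite inE leq_max => /orP [/eqP ->|/hD ->].
  by rewrite leqnn.
by rewrite orbT.
Qed.

Lemma dot_self_ge0 F : 0 <= dot F F.
Proof.
have [D hD] := degree_bound F; rewrite (dot_by_coef _ _ hD).
by apply: sum_ge0 => k _; nra.
Qed.

(** The coefficients at 0 and 1 give the main terms exactly; the others are dominated by a geometric
    series starting at k = 2, hence of order w^4. *)
Lemma dot_le_of_coef F w H : 0 < w -> w * w <= 1 / 2 ->
  coef F 0 = 1 -> coef F 1 = w ->
  (forall k, Rabs (coef F k) <= H * (w / (9 / 10)) ^ k) ->
  dot F F <= 1 + w * w + 5 * (H * H) * (w * w * (w * w)).
Proof.
move=> w0 w1 c0 c1 ck.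
have [D hD] := degree_bound F.
(* The bound is raised to [D.+1] so that the range surely contains both indices 0 and 1. *)
have {}hD (x : R * nat) : x \in F -> (x.2 <= D.+1)%N by move=> /hD; exact: leqW.
rewrite (dot_by_coef _ _ hD) [iota _ _]/= !big_cons c0 c1 Rmult_1_l Rplus_assoc.
apply: Rplus_le_compat_l; apply: Rplus_le_compat_l.
set s := w / (9 / 10) in ck.
have ss : s * s = w * w * (100 / 81) by rewrite /s; field.
apply: (Rle_trans _ (H * H * \sum_(k <- iota 2 D) (s * s) ^ k)).
  rewrite big_distrr; apply: sum_le => k _ /=.
  rewrite Rpow_mult_distr.
  have := ck k; have := Rabs_pos (coef F k).
  have -> : coef F k * coef F k = Rabs (coef F k) * Rabs (coef F k).
    by rewrite -Rabs_mult Rabs_pos_eq //; nra.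
  move=> h1 h2; have -> : H * H * (s ^ k * s ^ k) = (H * s ^ k) * (H * s ^ k) by ring.
  by apply: Rmult_le_compat.
have s1 : 0 <= s * s < 1 by split; rewrite ss; nra.
have := geometric_sum_le (s * s) 2 D s1.
set S := (X in X <= _) => hS.
(* With w^2 <= 1/2 the ratio of the series is at most 50/81, and (10/9)^4 / (1 - 50/81) is below
   5. *)
have hS' : S <= 5 * (w * w * (w * w)).
  apply: Rle_trans hS _; rewrite ss; apply/Rle_div_l; first lra.
  set W := w * w; have W0 : 0 < W by apply: Rmult_lt_0_compat.
  have W1 : W <= 1/2 by [].
  rewrite /= Rmult_1_r.
  have -> : W * (100 / 81) * (W * (100 / 81)) = W * W * (10000 / 6561) by field.
  have -> : 5 * (W * W) * (1 - W * (100 / 81)) = W * W * (5 * (1 - W * (100 / 81))) by ring.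
  apply: Rmult_le_compat_l; first nra.
  lra.
have HH : 0 <= H * H by nra.
by apply: Rle_trans (Rmult_le_compat_l _ _ _ HH hS') _; apply: Req_le; ring.
Qed.

Lemma coef_geom w K k : coef (geom w K) k = if (k <= K)%N then w ^ k else 0.
Proof.
transitivity (\sum_(j <- iota 0 K.+1) (if k == j then w ^ j else 0)).
  by rewrite /coef big_map; apply: eq_bigr => j _; rewrite eq_sym.
by rewrite sum_delta ?iota_uniq // mem_iota add0n ltnS.
Qed.

Lemma coef_lin0 b : coef (lin b) 0 = 1.
Proof. by rewrite /coef !big_cons big_nil /=; ring. Qed.

Lemma coef_lin1 b : coef (lin b) 1 = - b.
Proof. by rewrite /coef !big_cons big_nil /=; ring. Qed.

(** The base polynomial has linear coefficient w - (1 - 1/m) w = w/m, so its m-th power has linear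
    coefficient w. Higher coefficients are controlled by Cauchy's estimate. *)
Lemma dot_polyexp_le m w K : (0 < m)%N -> (0 < K)%N -> 0 < w -> w * w <= 1 / 2 ->
  let h := polyexp (conv addn (lin ((1 - / INR m) * w)) (geom w K)) m in
  dot h h <= 1 + w * w + 5 * (20 ^ m * 20 ^ m) * (w * w * (w * w)).
Proof.
move=> m0 K0 w0 w1; set F := conv _ _ _ => h.
have m1 : 1 <= INR m by apply: (le_INR 1); apply/leP.
have im : 0 < / INR m <= 1.
  split; first by apply: Rinv_0_lt_compat; lra.
  by rewrite -Rinv_1; apply: Rinv_le_contravar; lra.
have F0 : coef F 0 = 1 by rewrite coef_conv0 coef_lin0 coef_geom /=; ring.
have F1 : coef F 1 = w / INR m.
  by rewrite coef_conv1 coef_lin0 coef_lin1 !coef_geom K0 /=; field; lra.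
apply: dot_le_of_coef => //; first exact: coef_polyexp0.
  by rewrite coef_polyexp1 // F1; field; lra.
(* At radius (9/10)/w the linear factor weighs at most 1 + 9/10 <= 2 and the geometric factor at
   most 1/(1 - 9/10) = 10, whence [20 ^ m]. *)
move=> k; set r := 9 / 10 / w.
have r0 : 0 < r by apply: Rdiv_lt_0_compat; lra.
apply: Rle_trans (coef_weight r h k r0) _.
have -> : (w / (9 / 10)) ^ k = / r ^ k.
  by rewrite -pow_inv; congr (_ ^ _); rewrite /r; field; lra.
apply: Rmult_le_compat_r; first by apply: Rlt_le; apply: Rinv_0_lt_compat; exact: pow_lt.
rewrite weight_polyexp; apply: pow_incr; split; first by apply: weight_ge0; lra.
rewrite weight_conv.
have hl : weight r (lin ((1 - / INR m) * w)) <= 2.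
  rewrite /weight !big_cons big_nil /= Rabs_R1 Rabs_Ropp Rabs_pos_eq; last by nra.
  have -> : (1 - / INR m) * w * (r * 1) = (1 - / INR m) * (9 / 10) by rewrite /r; field; lra.
  lra.
have hg : weight r (geom w K) <= 10.
  rewrite /weight big_map /=.
  apply: (Rle_trans _ (\sum_(k <- iota 0 K.+1) (9 / 10) ^ k)).
    apply: sum_le => j _; rewrite Rabs_pos_eq; last by apply: pow_le; lra.
    by rewrite -Rpow_mult_distr; apply: Req_le; congr (_ ^ _); rewrite /r; field; lra.
  by apply: Rle_trans (geometric_sum_le _ _ _ _) _; [lra|rewrite /=; lra].
have -> : 20 = 2 * 10 by ring.
by apply: Rmult_le_compat => //; apply: weight_ge0; lra.
Qed.

(** Only the frequencies v and v + 1 occur on the left, and both lie within the truncated geometric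
    series: the value is w^v - b w w^(v+1). *)
Lemma dot_geom (v K : nat) w b : (v < K)%N ->
  dot (conv addn [:: (1, v)] (lin (b * w))) (geom w K) = w ^ v * (1 - b * (w * w)).
Proof.
move=> vK; move Eg : (geom w K) => g.
rewrite /dot big_conv big_seq1 !big_cons big_nil -Eg !big_map.
have E (j : nat) (c : R) : (j <= K)%N ->
    \sum_(k <- iota 0 K.+1) (if j == k then c * w ^ k else 0) = c * w ^ j.
  by move=> h; rewrite sum_delta ?iota_uniq // mem_iota add0n ltnS h.
have h0 : (v + 0 <= K)%N by rewrite addn0 ltnW.
have h1 : (v + 1 <= K)%N by rewrite addn1.
apply: etrans (f_equal2 Rplus (E _ (1 * 1) h0) (etrans (Rplus_0_r _) (E _ (1 * - (b * w)) h1))) _.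
by rewrite addn0 addn1 /=; ring.
Qed.

(** * Euler products on the imaginary line *)

Definition primes_le (N : nat) : seq nat := [seq q <- iota 0 N.+1 | prime q].
Definition nexp (s : R) (n : nat) : R := exp (- s * ln (INR n)).

Lemma primes_le_uniq N : uniq (primes_le N).
Proof. exact: filter_uniq (iota_uniq _ _). Qed.

Lemma primes_le_prime N : all prime (primes_le N).
Proof. exact: filter_all. Qed.

(** The factorisation runs over all primes up to N, with zero exponents allowed, so that one list of
    primes serves every n <= N. *)
Lemma prime_pow_prod n N : (0 < n <= N)%N ->
  n = \big[muln/1%N]_(q <- primes_le N) (q ^ logn q n)%N.
Proof.
move=> /andP [n0 nN]; rewrite -[LHS]partnT // (widen_partn predT nN) big_filter.
rewrite [RHS]big_mkcond /index_iota subn0; apply: eq_bigr => q _.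
by case: ifP => // pq; rewrite lognE pq.
Qed.

Lemma nexp_mul s n m : (0 < n)%N -> (0 < m)%N -> nexp s (n * m) = nexp s n * nexp s m.
Proof.
move=> /INR_gt0 n0 /INR_gt0 m0; rewrite /nexp -multE mult_INR ln_mult // -exp_plus.
by congr exp; ring.
Qed.

Lemma nexp1 s : nexp s 1 = 1.
Proof. by rewrite /nexp /= ln_1 Rmult_0_r exp_0. Qed.

Lemma nexp_expn s q e : (0 < q)%N -> nexp s (q ^ e) = nexp s q ^ e.
Proof.
move=> q0; elim: e => [|e IH]; first by rewrite expn0 nexp1.
by rewrite expnS nexp_mul ?IH // expn_gt0 q0.
Qed.

Lemma prime_prod_gt0 P (e : nat -> nat) : all prime P ->
  (0 < \big[muln/1%N]_(q <- P) (q ^ e q))%N.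
Proof.
elim: P => [|q P IH /= /andP [pq aP]]; first by rewrite big_nil.
by rewrite big_cons muln_gt0 expn_gt0 (prime_gt0 pq) IH.
Qed.

Lemma nexp_prime_prod s P (e : nat -> nat) : all prime P ->
  nexp s (\big[muln/1%N]_(q <- P) (q ^ e q)%N) = \prod_(q <- P) (nexp s q ^ e q).
Proof.
elim: P => [|q P IH /= /andP [pq aP]]; first by rewrite !big_nil nexp1.
rewrite !big_cons nexp_mul ?nexp_expn ?IH ?expn_gt0 ?(prime_gt0 pq) //.
exact: prime_prod_gt0.
Qed.

Lemma chi_prime_prod t P (e : nat -> nat) : all prime P ->
  chi (\big[muln/1%N]_(q <- P) (q ^ e q)%N) t = (\prod_(q <- P) chi (q ^ e q) t)%C.
Proof.
elim: P => [|q P IH /= /andP [pq aP]]; first by rewrite !big_nil chi1.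
rewrite !big_cons chi_mul ?IH ?expn_gt0 ?(prime_gt0 pq) //.
exact: prime_prod_gt0.
Qed.

(** Multiplication by n^(-it) shifts the factor at q by z^([logn q n]), so the result is again an
    Euler product, to which [dot_euler] applies. *)
Lemma chi_Ev_euler n N t h : (0 < n <= N)%N ->
  (chi n t * Ev (euler h (primes_le N)) t)%C =
  Ev (euler (fun q => conv addn [:: (1, logn q n)] (h q)) (primes_le N)) t.
Proof.
move=> hn; have aP := primes_le_prime N.
rewrite !Ev_euler // {1}(prime_pow_prod _ _ hn) chi_prime_prod // -big_split.
rewrite big_seq [RHS]big_seq; apply: eq_bigr => q hq.
have pq : prime q by exact: (allP aP).
rewrite at_prime_conv Ev_conv; try exact: posfreq_at_prime.
by congr Cmult; rewrite /Ev big_seq1 /= Cmult_1_l.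
Qed.

Lemma Cmod_prod (A : Type) (r : seq A) (g : A -> C) :
  Cmod (\prod_(x <- r) g x)%C = \prod_(x <- r) Cmod (g x).
Proof. exact: (big_morph Cmod Cmod_mult Cmod_1). Qed.

Lemma prod_pow (A : Type) (r : seq A) (g : A -> R) m :
  (\prod_(x <- r) g x) ^ m = \prod_(x <- r) (g x ^ m).
Proof.
apply: (big_morph (fun x => x ^ m)) => [x y|]; [exact: Rpow_mult_distr|exact: pow1].
Qed.

Lemma Cmod_Ev_polyexp q F m t : prime q ->
  Cmod (Ev (at_prime q (polyexp F m)) t) = Cmod (Ev (at_prime q F) t) ^ m.
Proof.
move=> pq; elim: m => [|m IH].
  by rewrite /Ev big_seq1 /= expn0 chi1 Cmult_1_l Cmod_1.
rewrite [polyexp _ _]/= at_prime_conv Ev_conv; try exact: posfreq_at_prime.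
by rewrite Cmod_mult IH.
Qed.

Lemma Cmod_Ev_euler_polyexp F P m t : all prime P ->
  Cmod (Ev (euler (fun q => polyexp (F q) m) P) t) = Cmod (Ev (euler F P) t) ^ m.
Proof.
move=> aP; rewrite !Ev_euler // !Cmod_prod prod_pow big_seq [RHS]big_seq.
by apply: eq_bigr => q hq; apply: Cmod_Ev_polyexp; exact: (allP aP).
Qed.

Lemma Ev_euler_conv F G P t : all prime P ->
  Ev (euler (fun q => conv addn (F q) (G q)) P) t = (Ev (euler F P) t * Ev (euler G P) t)%C.
Proof.
move=> aP; rewrite !Ev_euler // -big_split big_seq [RHS]big_seq.
apply: eq_bigr => q hq; have pq : prime q by exact: (allP aP).
by rewrite at_prime_conv Ev_conv; try exact: posfreq_at_prime.
Qed.

Lemma Cmod_Cconj z : Cmod (Cconj z) = Cmod z.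
Proof. by rewrite /Cmod /Cconj /=; congr sqrt; ring. Qed.

Lemma Re_mul_conj z : Re (z * Cconj z)%C = Cmod z ^ 2.
Proof.
rewrite /Cmod pow2_sqrt; first by case: z => u v; rewrite /=; ring.
by case: z => u v /=; nra.
Qed.

(** The even exponent is what makes this mean computable: |E|^(2m) = |E^m|^2, so Parseval applies to
    E^m, whose Euler factors are the m-th powers. *)
Lemma has_mean_kernel_norm m P F : all prime P -> uniq P ->
  has_mean (fun t => Cmod (Ev (euler F P) t) ^ (2 * m))
    (\prod_(q <- P) dot (polyexp (F q) m) (polyexp (F q) m)).
Proof.
move=> aP uP; rewrite -dot_euler //.
set H := euler (fun q => polyexp (F q) m) P; have hH : posfreq H by exact: posfreq_euler.
have -> : dot H H = Re (RtoC 1) * dot H H by rewrite /= Rmult_1_l.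
apply: has_mean_ext (has_mean_Ev (RtoC 1) H H hH hH) => t.
by rewrite Cmult_1_l Re_mul_conj Cmod_Ev_euler_polyexp // -pow_mult -multE Nat.mul_comm.
Qed.

(** The phase conj(z)/|z|, or 1 at z = 0. It lets bounds for real parts yield bounds for moduli. *)
Lemma unimodular_phase z : exists2 c, Cmod c <= 1 & Re (c * z)%C = Cmod z.
Proof.
case: (Req_dec (Cmod z) 0) => h.
  exists (RtoC 1); first by rewrite Cmod_1; lra.
  by rewrite h (Cmod_eq_0 _ h) /=; ring.
exists (/ Cmod z * Cconj z)%C.
  rewrite Cmod_mult Cmod_Cconj -RtoC_inv // Cmod_R Rabs_pos_eq; last first.
    by apply: Rlt_le; apply: Rinv_0_lt_compat; have := Cmod_ge_0 z; lra.
  by rewrite Rinv_l //; lra.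
rewrite -RtoC_inv //.
have -> : Re (RtoC (/ Cmod z) * Cconj z * z)%C = / Cmod z * Re (z * Cconj z)%C.
  by case: z {h} => u v; rewrite /=; ring.
by rewrite Re_mul_conj /=; field.
Qed.

(** * Dirichlet polynomials on the imaginary line *)

Definition imag_line (N : nat) (a : nat -> C) (t : R) : C :=
  (\sum_(n <- iota 1 N) (a n * chi n t))%C.

Lemma sum_n_m_big (f : nat -> C) N : sum_n_m f 1 N = (\sum_(n <- iota 1 N) f n)%C.
Proof.
elim: N => [|N IH]; first by rewrite big_nil sum_n_m_zero //; lia.
rewrite sum_n_Sm; last by lia.
by rewrite -(addn1 N) iotaD big_cat big_seq1 IH addn1 add1n.
Qed.

Lemma dir_poly_imag N a t : dir_poly N a (RtoC 0 + Ci * RtoC t)%C = imag_line N a t.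
Proof.
rewrite /dir_poly sum_n_m_big; apply: eq_bigr => n _; congr Cmult.
rewrite /npow_neg /chi.
have -> : Re (RtoC 0 + Ci * RtoC t)%C = 0 by rewrite /=; ring.
have -> : Im (RtoC 0 + Ci * RtoC t)%C = t by rewrite /=; ring.
by rewrite Ropp_0 Rmult_0_l exp_0 !Rmult_1_l.
Qed.

Lemma dir_poly_real N a x :
  dir_poly N a (RtoC x) = (\sum_(n <- iota 1 N) (a n * RtoC (nexp x n)))%C.
Proof.
rewrite /dir_poly sum_n_m_big; apply: eq_bigr => n _; congr Cmult.
by rewrite /npow_neg /= Rmult_0_l cos_0 sin_0 Rmult_0_r Rmult_1_r Ropp_0.
Qed.

Lemma Hp_norm_trunc p N a : Hp_norm p N a = real (Lim_seq (trunc_norm p (imag_line N a))).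
Proof.
rewrite /Hp_norm /Lim; congr real; apply: Lim_seq_ext => k.
rewrite /trunc_norm /avg /Rbar_loc_seq; congr (rpow (_ * _) _).
by apply: RInt_ext => t _; rewrite dir_poly_imag.
Qed.

Lemma continuous_sum (A : Type) (r : seq A) (g : A -> R -> R) t :
  (forall x, continuous (g x) t) -> continuous (fun s => \sum_(x <- r) g x s) t.
Proof.
move=> H; elim: r => [|x r IH].
  by apply: (continuous_ext (fun _ => 0)) => [s|]; [rewrite big_nil|exact: continuous_const].
apply: (continuous_ext (fun s => g x s + \sum_(x <- r) g x s)) => [s|]; first by rewrite big_cons.
exact: (continuous_plus (g x)).
Qed.

Lemma Im_sum (A : Type) (r : seq A) (g : A -> C) :
  Im (\sum_(x <- r) g x)%C = \sum_(x <- r) Im (g x).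
Proof. exact: (big_morph Im). Qed.

Lemma continuous_Cmod_imag_line N a t : continuous (fun t => Cmod (imag_line N a t)) t.
Proof.
have cR : continuous (fun s => Re (imag_line N a s)) t.
  apply: (continuous_ext (fun s => \sum_(n <- iota 1 N) Re (a n * chi n s)%C)).
    by move=> s; rewrite Re_sum.
  apply: continuous_sum => n; apply: (ex_derive_continuous (fun s => Re (a n * chi n s)%C)).
  by rewrite /chi /=; auto_derive.
have cI : continuous (fun s => Im (imag_line N a s)) t.
  apply: (continuous_ext (fun s => \sum_(n <- iota 1 N) Im (a n * chi n s)%C)).
    by move=> s; rewrite Im_sum.
  apply: continuous_sum => n; apply: (ex_derive_continuous (fun s => Im (a n * chi n s)%C)).
  by rewrite /chi /=; auto_derive.
apply: (continuous_ext (fun s => sqrt (Re (imag_line N a s) * Re (imag_line N a s)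
    + Im (imag_line N a s) * Im (imag_line N a s)))).
  by move=> s; rewrite /Cmod /Re /Im /=; congr sqrt; ring.
apply: continuous_sqrt_comp.
apply: (continuous_plus (fun s => Re (imag_line N a s) * Re (imag_line N a s))).
  exact: (continuous_mult (fun s => Re (imag_line N a s))).
exact: (continuous_mult (fun s => Im (imag_line N a s))).
Qed.

Lemma Cmod_chi n t : Cmod (chi n t) = 1.
Proof.
rewrite /Cmod /chi /=; apply: etrans sqrt_1; congr sqrt.
by have := sin2_cos2 (t * ln (INR n)); rewrite /Rsqr => h; nra.
Qed.

Lemma Cmod_sum_le (A : Type) (r : seq A) (g : A -> C) :
  Cmod (\sum_(x <- r) g x)%C <= \sum_(x <- r) Cmod (g x).
Proof.
elim: r => [|x r IH]; first by rewrite !big_nil Cmod_0; lra.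
by rewrite !big_cons; apply: Rle_trans (Cmod_triangle _ _) _; apply: Rplus_le_compat_l.
Qed.

Lemma Hp_norm_duality p m N a (G : R -> C) c Y mu nu : 1 < p ->
  1 <= (p - 1) * (INR (2 * m) - 1) -> 0 < Y -> Cmod c <= 1 ->
  has_mean (fun t => Cmod (G t) ^ (2 * m)) mu -> mu <= Y ^ (2 * m) ->
  has_mean (fun t => Re (c * (imag_line N a t * G t))%C) nu ->
  nu <= 3 * Y * Hp_norm p N a.
Proof.
move=> p1 hm Y0 hc hG hY hfG; rewrite Hp_norm_trunc.
apply: (norm_duality p m _ G c Y (\sum_(n <- iota 1 N) Cmod (a n)) mu) => //.
  exact: continuous_Cmod_imag_line.
move=> t; apply: Rle_trans (Cmod_sum_le _ _ _) _; apply: Req_le; apply: eq_bigr => n _.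
by rewrite Cmod_mult Cmod_chi Rmult_1_r.
Qed.

(** Duality against n^(it), which has modulus 1 (so [Y] is 1) and whose mean against f picks out
    a_n. *)
Lemma coef_bound p m N a n : 1 < p -> 1 <= (p - 1) * (INR (2 * m) - 1) ->
  (0 < n <= N)%N -> Cmod (a n) <= 3 * Hp_norm p N a.
Proof.
move=> p1 hm hn; have [c c1 hc] := unimodular_phase (a n).
have := Hp_norm_duality p m N a (fun t => Cconj (chi n t)) c 1 1 (Cmod (a n)) p1 hm.
rewrite Rmult_1_r; apply; rewrite ?pow1 //; try lra.
  have := has_mean_chi (RtoC 1) 1 1 isT isT; apply: has_mean_ext => t.
  by rewrite Cmod_Cconj Cmod_chi pow1 Cmult_1_l chi1 /=; ring.
have -> : Cmod (a n) = \sum_(k <- iota 1 N) (if k == n then Re (c * a k)%C else 0).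
  under eq_bigr => k _ do rewrite eq_sym.
  by rewrite sum_delta ?iota_uniq // mem_iota add1n ltnS hn hc.
apply: (has_mean_ext (fun t => \sum_(k <- iota 1 N) Re (c * a k * (chi k t * Cconj (chi n t)))%C)).
  move=> t; rewrite -Re_sum; congr Re; rewrite /imag_line big_distrl big_distrr.
  by apply: eq_bigr => k _ /=; ring.
apply: (has_mean_big _ (iota 1 N)) => k; rewrite mem_iota => /andP [k0 _].
by apply: has_mean_chi => //; case/andP: hn.
Qed.

(** * Point evaluation *)

Lemma nexp_gt0 s n : 0 < nexp s n.
Proof. exact: exp_pos. Qed.

Lemma nexp_sq s n : nexp s n * nexp s n = nexp (2 * s) n.
Proof. by rewrite /nexp -exp_plus; congr exp; ring. Qed.

Lemma ln_INR_ge_ln2 n : (2 <= n)%N -> ln 2 <= ln (INR n).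
Proof. by move=> /leP h; apply: ln_le; [lra|apply: (le_INR 2)]. Qed.

Lemma nexp_sq_le_half s q : 1 / 2 <= s -> prime q -> nexp s q * nexp s q <= 1 / 2.
Proof.
move=> hs /prime_gt1 /ln_INR_ge_ln2 q2; rewrite nexp_sq /nexp.
have -> : 1 / 2 = exp (- ln 2) by rewrite exp_Ropp exp_ln; lra.
have := ln_lt_2 => l2; apply: exp_le; nra.
Qed.

(** Duality against G = B conj(A). The mean of n^(-it) G is a product of [dot_geom] values, namely
    n^(-s) times a factor [B] independent of n, so the mean of f G is f(s) times that factor. *)
Lemma point_eval_dual p m N a s Y : 1 < p -> 1 <= (p - 1) * (INR (2 * m) - 1) ->
  (0 < m)%N -> 1 / 2 <= s -> 0 < Y ->
  \prod_(q <- primes_le N) (1 + nexp s q * nexp s q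
     + 5 * (20 ^ m * 20 ^ m) * (nexp s q * nexp s q * (nexp s q * nexp s q))) <= Y ^ (2 * m) ->
  Cmod (dir_poly N a (RtoC s)) *
    \prod_(q <- primes_le N) (1 - (1 - / INR m) * (nexp s q * nexp s q))
  <= 3 * Y * Hp_norm p N a.
Proof.
move=> p1 hm m0 hs Y0 hY; set b := 1 - / INR m; set P := primes_le N.
have aP : all prime P := primes_le_prime N.
have uP : uniq P := primes_le_uniq N.
pose l q := lin (b * nexp s q).
(* Degree [N.+1] exceeds [logn q n] for every n <= N, as [dot_geom] requires. *)
pose g q := geom (nexp s q) N.+1.
pose G t := (Ev (euler l P) t * Cconj (Ev (euler g P) t))%C.
have [c c1 hc] := unimodular_phase (dir_poly N a (RtoC s)).
set B := \prod_(q <- P) _.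
apply: (Hp_norm_duality p m N a G c Y
  (\prod_(q <- P) dot (polyexp (conv addn (l q) (g q)) m) (polyexp (conv addn (l q) (g q)) m))) => //.
- have := has_mean_kernel_norm m P (fun q => conv addn (l q) (g q)) aP uP.
  apply: has_mean_ext => t.
  by rewrite Ev_euler_conv // /G !Cmod_mult Cmod_Cconj.
- apply: Rle_trans hY; apply: (proj2 (prod_le _ _ _ _ _)) => q hq; split; first exact: dot_self_ge0.
  apply: dot_polyexp_le => //; first exact: nexp_gt0.
  by apply: nexp_sq_le_half => //; exact: (allP aP).
have -> : Cmod (dir_poly N a (RtoC s)) * B =
    \sum_(n <- iota 1 N) (Re (c * a n)%C * (nexp s n * B)).
  rewrite -hc dir_poly_real big_distrr Re_sum big_distrl; apply: eq_bigr => n _ /=.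
  ring.
apply: (has_mean_ext (fun t => \sum_(n <- iota 1 N) Re (c * a n *
  (Ev (euler (fun q => conv addn [:: (1, logn q n)] (l q)) P) t * Cconj (Ev (euler g P) t)))%C)).
  move=> t; rewrite -Re_sum; congr Re; rewrite /imag_line big_distrl big_distrr.
  rewrite big_seq [RHS]big_seq; apply: eq_bigr => n; rewrite mem_iota add1n ltnS => hn.
  rewrite -(chi_Ev_euler n N t l hn) /G -/P.
  by move: (Ev (euler l P) t) (Cconj _) => u v /=; ring.
apply: (has_mean_big _ (iota 1 N)) => n; rewrite mem_iota add1n ltnS => hn.
have -> : nexp s n * B =
    dot (euler (fun q => conv addn [:: (1, logn q n)] (l q)) P) (euler g P).
  rewrite dot_euler // {1}(prime_pow_prod _ _ hn) nexp_prime_prod // -big_split.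
  rewrite [LHS]big_seq [RHS]big_seq; apply: eq_bigr => q hq /=.
  rewrite dot_geom //; case/andP: hn => n0 nN.
  by apply: leq_trans (ltn_logl _ n0) _; apply: leqW.
by apply: has_mean_Ev; exact: posfreq_euler.
Qed.

(** * Bounds for products over primes and for partial sums of zeta *)

Lemma prod_exp (A : Type) (r : seq A) (g : A -> R) :
  \prod_(x <- r) exp (g x) = exp (\sum_(x <- r) g x).
Proof. by rewrite (big_morph exp exp_plus exp_0). Qed.

(** Taking y = x/(1+x) in 1 - y <= exp(-y) gives exp(x/(1+x)) <= 1 + x, and x/(1+x) >= x - x^2. *)
Lemma one_add_ge_exp x : 0 <= x -> exp (x - x * x) <= 1 + x.
Proof.
move=> x0.
have h : 1 - x / (1 + x) <= exp (- (x / (1 + x))).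
  by have := exp_ineq1_le (- (x / (1 + x))); lra.
have e : 1 - x / (1 + x) = / (1 + x) by field; lra.
have hx : exp (x / (1 + x)) <= 1 + x.
  rewrite -[X in X <= _]Rinv_inv -exp_Ropp -[X in _ <= X]Rinv_inv -e.
  apply: Rinv_le_contravar => //; rewrite e; apply: Rinv_0_lt_compat; lra.
apply: Rle_trans hx; apply: exp_le; apply/Rle_div_r; first lra.
nra.
Qed.

(** For y <= 1/2 one has (1 - y)(1 + y + 2y^2) = 1 + y^2 - 2y^3 >= 1, so 1/(1 - y) <= exp(y +
    2y^2). *)
Lemma one_sub_ge_exp y : 0 <= y <= 1 / 2 -> exp (- (y + 2 * (y * y))) <= 1 - y.
Proof.
move=> hy.
have h : / (1 - y) <= exp (y + 2 * (y * y)).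
  apply: Rle_trans (exp_ineq1_le _).
  by rewrite -[X in X <= _]Rmult_1_l; apply/Rle_div_l; [lra|nra].
rewrite exp_Ropp -[X in _ <= X]Rinv_inv; apply: Rinv_le_contravar => //.
by apply: Rinv_0_lt_compat; lra.
Qed.

(** The integral test in discrete form, from ln((n+1)/n) >= 1/(n+1) and exp(v) >= 1 + v; the right
    side telescopes. *)
Lemma zeta_step s n : 1 < s -> (0 < n)%N ->
  nexp s n.+1 * (s - 1) <= nexp (s - 1) n - nexp (s - 1) n.+1.
Proof.
move=> s1 n0; have i0 := INR_gt0 n n0; have j0 := INR_gt0 n.+1 isT.
set u := ln (INR n.+1) - ln (INR n).
have u1 : / INR n.+1 <= u.
  rewrite /u -ln_div // -[X in X <= _]ln_exp; apply: ln_le; first exact: exp_pos.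
  rewrite -[exp _]Rinv_inv -exp_Ropp -[X in _ <= X]Rinv_inv.
  have e : / (INR n.+1 / INR n) = 1 + - / INR n.+1 by rewrite S_INR in j0 *; field; lra.
  apply: Rinv_le_contravar; last by rewrite e; exact: exp_ineq1_le.
  by apply: Rinv_0_lt_compat; exact: Rdiv_lt_0_compat.
have -> : nexp (s - 1) n = nexp (s - 1) n.+1 * exp ((s - 1) * u).
  by rewrite /nexp -exp_plus; congr exp; rewrite /u; ring.
have -> : nexp s n.+1 = nexp (s - 1) n.+1 * / INR n.+1.
  rewrite /nexp -[X in _ * / X]exp_ln // -exp_Ropp -exp_plus; congr exp; ring.
have := exp_ineq1_le ((s - 1) * u) => h.
have P := nexp_gt0 (s - 1) n.+1.
have -> : nexp (s - 1) n.+1 * / INR n.+1 * (s - 1) = nexp (s - 1) n.+1 * ((s - 1) * / INR n.+1) by ring.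
have -> : nexp (s - 1) n.+1 * exp ((s - 1) * u) - nexp (s - 1) n.+1 =
  nexp (s - 1) n.+1 * (exp ((s - 1) * u) - 1) by ring.
apply: Rmult_le_compat_l; first lra.
have : (s - 1) * / INR n.+1 <= (s - 1) * u by apply: Rmult_le_compat_l; lra.
lra.
Qed.

Lemma zeta_partial_le s N : 1 < s -> \sum_(n <- iota 1 N) nexp s n <= 1 + / (s - 1).
Proof.
move=> s1; have i0 : 0 < / (s - 1) by apply: Rinv_0_lt_compat; lra.
case: N => [|N]; first by rewrite big_nil; lra.
(* The boundary term is kept to make the induction close. *)
suff : \sum_(n <- iota 1 N.+1) nexp s n * (s - 1) <= s - nexp (s - 1) N.+1.
  rewrite -big_distrl /= => /Rle_div_r; have := nexp_gt0 (s - 1) N.+1 => P h.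
  have {}h := h ltac:(lra); apply: Rle_trans h _; apply/Rle_div_l; first lra.
  by have -> : (1 + / (s - 1)) * (s - 1) = s by [field; lra]; lra.
elim: N => [|N IH]; first by rewrite big_seq1 !nexp1; lra.
rewrite -(addn1 N.+1) iotaD big_cat big_seq1 /= add1n addn1.
have := zeta_step s N.+1 s1 isT; rewrite /= in IH *; lra.
Qed.

Lemma sum_uniq_le (L : seq nat) M (g : nat -> R) : uniq L ->
  (forall n, n \in L -> (0 < n <= M)%N) -> (forall n, 0 <= g n) ->
  \sum_(n <- L) g n <= \sum_(n <- iota 1 M) g n.
Proof.
move=> uL hL g0.
have -> : \sum_(n <- L) g n = \sum_(n <- [seq n <- iota 1 M | n \in L]) g n.
  apply: perm_big; apply: uniq_perm => //; first exact: filter_uniq (iota_uniq _ _).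
  move=> n; rewrite mem_filter mem_iota add1n ltnS.
  by case: (boolP (n \in L)) => //= /hL ->.
rewrite big_filter big_mkcond; apply: sum_le => n _.
by case: ifP => _; [lra|exact: g0].
Qed.

(** One entry for each sublist of [P], namely its product: the integers that appear when the product
    of the factors 1 + q^(-s) is multiplied out. *)
Definition sqfree_prods (P : seq nat) : seq nat :=
  foldr (fun q L => L ++ [seq (q * n)%N | n <- L]) [:: 1%N] P.

Lemma sqfree_prods_gt0 P n : all prime P -> n \in sqfree_prods P -> (0 < n)%N.
Proof.
elim: P n => [|q P IH] n /=; first by rewrite inE => _ /eqP ->.
move=> /andP [pq aP]; rewrite mem_cat => /orP [/(IH _ aP) //|/mapP [k hk ->]].
by rewrite muln_gt0 prime_gt0 // IH.
Qed.

Lemma sqfree_prods_coprime P q n : all prime P -> prime q -> q \notin P ->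
  n \in sqfree_prods P -> ~~ (q %| n)%N.
Proof.
move=> + pq; elim: P n => [|r P IH] n /=.
  by rewrite inE => _ _ /eqP ->; rewrite dvdn1; case: q pq => [|[|]].
move=> /andP [pr aP]; rewrite inE negb_or => /andP [qr qP].
rewrite mem_cat => /orP [|/mapP [k hk ->]]; first exact: IH.
by rewrite Euclid_dvdM // negb_or dvdn_prime2 // qr IH.
Qed.

(** Adjoining q appends multiples of q to integers not divisible by q, so no repetition arises. *)
Lemma sqfree_prods_uniq P : all prime P -> uniq P -> uniq (sqfree_prods P).
Proof.
elim: P => [//|q P IH] /= /andP [pq aP] /andP [qP uP].
rewrite cat_uniq IH //= map_inj_in_uniq ?IH // ?andbT.
  apply/hasPn => n /mapP [k hk ->]; apply/negP => /(sqfree_prods_coprime _ _ _ aP pq qP).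
  by rewrite dvdn_mulr.
by move=> k l _ _ /eqP; rewrite eqn_pmul2l ?prime_gt0 // => /eqP.
Qed.

Lemma prod_one_add_nexp P s : all prime P ->
  \prod_(q <- P) (1 + nexp s q) = \sum_(n <- sqfree_prods P) nexp s n.
Proof.
elim: P => [|q P IH] /=; first by rewrite big_nil big_seq1 nexp1.
move=> /andP [pq aP]; rewrite big_cons IH // big_cat big_map.
have -> : \sum_(n <- sqfree_prods P) nexp s (q * n) =
    nexp s q * \sum_(n <- sqfree_prods P) nexp s n.
  rewrite big_distrr big_seq [RHS]big_seq; apply: eq_bigr => n hn.
  by rewrite nexp_mul ?(prime_gt0 pq) // (sqfree_prods_gt0 P _ aP hn).
by rewrite /=; ring.
Qed.

(** Expanded, the product is a sum of n^(-s) over distinct positive integers, hence at most a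
    partial sum of zeta(s). *)
Lemma prod_primes_le P s : 1 < s -> all prime P -> uniq P ->
  \prod_(q <- P) (1 + nexp s q) <= 1 + / (s - 1).
Proof.
move=> s1 aP uP; rewrite prod_one_add_nexp //.
have [M hM] : exists M, forall n, n \in sqfree_prods P -> (n <= M)%N.
  elim: (sqfree_prods P) => [|k L [M hM]]; first by exists 0%N.
  exists (maxn k M) => n; rewrite inE leq_max => /orP [/eqP ->|/hM ->].
    by rewrite leqnn.
  by rewrite orbT.
apply: Rle_trans (zeta_partial_le s M s1).
apply: sum_uniq_le; first exact: sqfree_prods_uniq.
  by move=> n hn; rewrite (sqfree_prods_gt0 P) // hM.
by move=> n; apply: Rlt_le; exact: nexp_gt0.
Qed.

Lemma Hp_norm_ge0 p N a : 0 <= Hp_norm p N a.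
Proof.
rewrite Hp_norm_trunc.
have : Rbar_le 0 (Lim_seq (trunc_norm p (imag_line N a))).
  by rewrite -(Lim_seq_const 0); apply: Lim_seq_le_loc; exists 0%N => k _; exact: rpow_ge0.
by case: Lim_seq => //=; lra.
Qed.

Lemma exp_INR_mul n x : exp x ^ n = exp (INR n * x).
Proof. by rewrite -Rpower_pow ?/Rpower ?ln_exp //; exact: exp_pos. Qed.

(** With S2 the sum of q^(-2s), the norm of the dual function costs exp(S2/(2m)) and division by the
    product of 1 - b q^(-2s) costs exp((1 - 1/m) S2), up to bounded factors. The exponents add up to
    1 - 1/(2m), which is less than 1. *)
Lemma point_eval p m : 1 < p -> 1 <= (p - 1) * (INR (2 * m) - 1) -> (0 < m)%N ->
  exists2 K, 0 <= K & forall N a s, 1 / 2 < s <= 2 ->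
  Cmod (dir_poly N a (RtoC s)) <=
  K * exp ((1 - / INR (2 * m)) * ln (2 / (s - 1 / 2))) * Hp_norm p N a.
Proof.
move=> p1 hm m0; set H := 5 * (20 ^ m * 20 ^ m).
have H0 : 0 <= H by have := pow_lt 20 m; rewrite /H => /(_ ltac:(lra)) h; nra.
have m1 : 1 <= INR m by apply: (le_INR 1); apply/leP.
have E2 : INR (2 * m) = 2 * INR m by rewrite -multE mult_INR.
have i0 : 0 < / INR m by apply: Rinv_0_lt_compat; lra.
have i1 : / INR m <= 1 by rewrite -Rinv_1; apply: Rinv_le_contravar; lra.
have Ei : / INR (2 * m) = / INR m / 2 by rewrite E2; field; lra.
set C4 := / INR (2 * m) * H + 2.
have C40 : 0 <= C4 by rewrite /C4 Ei; nra.
(* The 3 comes from duality. The error exponent is at most (1 + C4) S4, where S4 is the sum of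
   q^(-4s), and S4 <= 2. *)
exists (3 * exp (2 * (1 + C4))); first by have := exp_pos (2 * (1 + C4)); lra.
move=> N a s hs; set P := primes_le N.
have aP : all prime P := primes_le_prime N.
have uP : uniq P := primes_le_uniq N.
pose x q := nexp s q * nexp s q.
have x0 q : 0 < x q by rewrite /x; have := nexp_gt0 s q; nra.
set S2 := \sum_(q <- P) x q; set S4 := \sum_(q <- P) (x q * x q).
have S40 : 0 <= S4 by apply: sum_ge0 => q _; have := x0 q; nra.
(* Since 4s > 2, the bound 1 + 1/(4s - 1) for the partial sums of zeta(4s) is at most 2. *)
have S4le : S4 <= 2.
  have -> : S4 = \sum_(q <- P) nexp (4 * s) q.
    by apply: eq_bigr => q _; rewrite /x !nexp_sq; congr nexp; ring.
  apply: Rle_trans (sum_uniq_le _ N _ uP _ _) _.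
  - move=> q; rewrite mem_filter mem_iota ltnS => /andP [/prime_gt0 -> /andP [_ h]] //.
  - by move=> n; apply: Rlt_le; exact: nexp_gt0.
  apply: Rle_trans (zeta_partial_le _ _ _) _; first lra.
  have : / (4 * s - 1) <= / 1 by apply: Rinv_le_contravar; lra.
  by rewrite Rinv_1; lra.
have z0 : 0 < 2 / (s - 1 / 2) by apply: Rdiv_lt_0_compat; lra.
(* The product of 1 + q^(-2s) is at most 1 + 1/(2s - 1) = s/(s - 1/2), and s <= 2; passing from the
   product to the sum in the exponent costs S4. *)
have S2le : S2 <= ln (2 / (s - 1 / 2)) + S4.
  suff : exp (S2 - S4) <= 2 / (s - 1 / 2).
    move=> /(ln_le _ _ (exp_pos _)); rewrite ln_exp; lra.
  have -> : S2 - S4 = \sum_(q <- P) (x q - x q * x q).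
    rewrite /S2 /S4; elim: P {aP uP S40 S4le S2 S4} => [|q P IH]; first by rewrite !big_nil; ring.
    by rewrite !big_cons -IH; ring.
  rewrite -prod_exp.
  apply: (Rle_trans _ (\prod_(q <- P) (1 + nexp (2 * s) q))).
    apply: (proj2 (prod_le _ _ _ _ _)) => q _; split; first by apply: Rlt_le; exact: exp_pos.
    by rewrite -nexp_sq; apply: one_add_ge_exp; apply: Rlt_le; exact: x0.
  apply: Rle_trans (prod_primes_le _ _ _ aP uP) _; first lra.
  have -> : 1 + / (2 * s - 1) = s / (s - 1 / 2) by field; lra.
  by apply: Rmult_le_compat_r; [apply: Rlt_le; apply: Rinv_0_lt_compat; lra|lra].
set T := \sum_(q <- P) (x q + H * (x q * x q)).
have ET : T = S2 + H * S4.
  by rewrite /T /S4 big_split big_distrr.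
(* Chosen so that [Y ^ (2 * m)] is [exp T], which dominates the product in [point_eval_dual] by 1 +
   u <= exp(u) in each factor. *)
set Y := exp (/ INR (2 * m) * T).
have Y0 : 0 < Y by exact: exp_pos.
have YT : Y ^ (2 * m) = exp T.
  by rewrite /Y exp_INR_mul; congr exp; rewrite E2; field; lra.
have := point_eval_dual p m N a s Y p1 hm m0 _ Y0; rewrite YT => D.
have {}D := D ltac:(lra) _.
set b := 1 - / INR m.
have Bge : exp (- (b * S2 + 2 * S4)) <= \prod_(q <- P) (1 - b * x q).
  have -> : - (b * S2 + 2 * S4) = \sum_(q <- P) (- (b * x q + 2 * (x q * x q))).
    rewrite /S2 /S4; elim: P {aP uP S40 S4le S2 S4 S2le T ET Y Y0 YT D} => [|q P IH].
      by rewrite !big_nil; ring.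
    by rewrite !big_cons -IH; ring.
  rewrite -prod_exp; apply: (proj2 (prod_le _ _ _ _ _)) => q hq.
  split; first by apply: Rlt_le; exact: exp_pos.
  have xh : x q <= 1 / 2 by apply: nexp_sq_le_half; [lra|exact: (allP aP)].
  have xq := x0 q; have b1 : 0 <= b <= 1 by rewrite /b; lra.
  have y0 : 0 <= b * x q <= x q by nra.
  apply: Rle_trans (one_sub_ge_exp _ _); last lra.
  by apply: exp_le; nra.
have {}D : Cmod (dir_poly N a (RtoC s)) * exp (- (b * S2 + 2 * S4)) <= 3 * Y * Hp_norm p N a.
  apply: Rle_trans (D _).
    by apply: Rmult_le_compat_l; [exact: Cmod_ge_0|].
  rewrite /T -prod_exp; apply: (proj2 (prod_le _ _ _ _ _)) => q hq; have xq := x0 q.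
  split; first by rewrite -/(x q); nra.
  by apply: Rle_trans (exp_ineq1_le _); rewrite /x /H; lra.
move: D; rewrite exp_Ropp => /Rle_div_l; set e := exp (b * S2 + 2 * S4).
have e0 : 0 < e by exact: exp_pos.
move=> D; have {}D := D e0.
apply: Rle_trans D _.
have -> : 3 * Y * Hp_norm p N a * e = 3 * (Y * e) * Hp_norm p N a by ring.
apply: Rmult_le_compat_r; first exact: Hp_norm_ge0.
rewrite Rmult_assoc; apply: Rmult_le_compat_l; first lra.
rewrite /Y /e -!exp_plus; apply: exp_le; rewrite ET.
have -> : / INR (2 * m) * (S2 + H * S4) + (b * S2 + 2 * S4) = (1 - / INR (2 * m)) * S2 + C4 * S4.
  by rewrite /C4 /b E2; field; lra.
have g0 : 0 <= 1 - / INR (2 * m) <= 1 by rewrite Ei; lra.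
have : (1 - / INR (2 * m)) * S2 <= (1 - / INR (2 * m)) * (ln (2 / (s - 1 / 2)) + S4).
  by apply: Rmult_le_compat_l; lra.
nra.
Qed.

(** * The functional *)

Definition real_dir (N : nat) (r : nat -> R) (x : R) : R :=
  \sum_(n <- iota 2 N.-1) (r n * nexp x n).
(** The negative of an antiderivative of [real_dir], normalised to vanish at infinity. Its value at
    1/2 is therefore the integral over the half-line. *)
Definition real_dir_prim (N : nat) (r : nat -> R) (x : R) : R :=
  \sum_(n <- iota 2 N.-1) (r n * (nexp x n / ln (INR n))).

Lemma is_derive_sum (A : eqType) (r : seq A) (f : A -> R -> R) (df : A -> R) x :
  (forall n, n \in r -> is_derive (f n) x (df n)) ->
  is_derive (fun y => \sum_(n <- r) f n y) x (\sum_(n <- r) df n).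
Proof.
elim: r => [|n r IH] H.
  rewrite big_nil; apply: (is_derive_ext (fun _ => 0)) => [y|]; first by rewrite big_nil.
  exact: is_derive_const.
rewrite big_cons; apply: (is_derive_ext (fun y => f n y + \sum_(k <- r) f k y)).
  by move=> y; rewrite big_cons.
apply: (is_derive_plus (f n)); first by apply: H; exact: mem_head.
by apply: IH => k hk; apply: H; rewrite inE hk orbT.
Qed.

Lemma ln_INR_gt0 n : (2 <= n)%N -> 0 < ln (INR n).
Proof. by move=> /ln_INR_ge_ln2; have := ln_lt_2; lra. Qed.

Lemma real_dir_prim_derive N r x : is_derive (real_dir_prim N r) x (- real_dir N r x).
Proof.
have -> : - real_dir N r x = \sum_(n <- iota 2 N.-1) (- (r n * nexp x n)).
  by rewrite /real_dir (big_morph Ropp Ropp_plus_distr Ropp_0).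
apply: is_derive_sum => n; rewrite mem_iota => /andP [/ln_INR_gt0 n2 _].
by rewrite /nexp; auto_derive => //; field; lra.
Qed.

Lemma is_RInt_real_dir N r a b :
  is_RInt (real_dir N r) a b (real_dir_prim N r a - real_dir_prim N r b).
Proof.
have -> : real_dir_prim N r a - real_dir_prim N r b =
   minus (- real_dir_prim N r b) (- real_dir_prim N r a).
  by rewrite /minus /plus /opp /=; ring.
apply: (is_RInt_derive (fun x => - real_dir_prim N r x)) => x _.
  rewrite -(Ropp_involutive (real_dir N r x)).
  exact: (is_derive_opp (real_dir_prim N r) _ _ (real_dir_prim_derive N r x)).
apply: continuous_sum => n; apply: (ex_derive_continuous (fun x => r n * nexp x n)).
by rewrite /nexp; auto_derive.
Qed.

Lemma real_dir_prim_lim N r : is_lim (real_dir_prim N r) p_infty 0.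
Proof.
rewrite /real_dir_prim; have : all (leq 2) (iota 2 N.-1).
  by apply/allP => n; rewrite mem_iota => /andP [].
elim: (iota 2 N.-1) => [_|n l IH /= /andP [/ln_INR_gt0 n2 hl]].
  by apply: (is_lim_ext (fun _ => 0)) => [y|]; [rewrite big_nil|exact: is_lim_const].
apply: (is_lim_ext (fun x => r n / ln (INR n) * nexp x n + \sum_(k <- l) (r k * (nexp x k / ln (INR k))))).
  by move=> y; rewrite big_cons; congr (_ + _); rewrite /Rdiv; ring.
suff h : is_lim (fun x => nexp x n) p_infty 0.
  have := is_lim_plus' _ _ _ _ _ (is_lim_scal_l _ (r n / ln (INR n)) p_infty 0 h) (IH hl).
  by rewrite Rmult_0_r Rplus_0_r.
apply: (filterlim_comp _ _ _ (fun x => - x * ln (INR n)) exp _ (Rbar_locally m_infty)).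
  move=> P [M hM]; exists (- M / ln (INR n)) => x hx; apply: hM.
  by move: hx => /Rlt_div_l => /(_ n2); lra.
exact: is_lim_exp_m.
Qed.

Lemma dir_poly_sub_coef N a x :
  Cminus (dir_poly N a (RtoC x)) (dir_coef N a 1%N) =
  (real_dir N (fun n => Re (a n)) x, real_dir N (fun n => Im (a n)) x).
Proof.
have -> : Cminus (dir_poly N a (RtoC x)) (dir_coef N a 1%N) =
    (\sum_(n <- iota 2 N.-1) (a n * RtoC (nexp x n)))%C.
  rewrite dir_poly_real; case: N => [|N]; first by rewrite !big_nil /dir_coef /=; ring.
  by rewrite [iota 1 _]/= big_cons nexp1 /dir_coef /=; ring.
set z := (\sum_(n <- _) _)%C; rewrite [z]surjective_pairing -/(Re z) -/(Im z) Re_sum Im_sum.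
by rewrite /real_dir; congr (_, _); apply: eq_bigr => n _; rewrite /Re /Im /=; ring.
Qed.

Lemma is_RInt_gen_dir_poly N a :
  is_RInt_gen (fun x : R => Cminus (dir_poly N a (RtoC x)) (dir_coef N a 1%N))
    (at_point (1/2)) (Rbar_locally p_infty)
    (real_dir_prim N (fun n => Re (a n)) (1/2), real_dir_prim N (fun n => Im (a n)) (1/2)).
Proof.
set u := fun n => Re (a n); set v := fun n => Im (a n).
have lu r : is_lim (fun b => real_dir_prim N r (1/2) - real_dir_prim N r b) p_infty
   (real_dir_prim N r (1/2)).
  have -> : real_dir_prim N r (1/2) = real_dir_prim N r (1/2) - 0 by ring.
  rewrite {1}Rminus_0_r; apply: is_lim_minus'; first exact: is_lim_const.
  exact: real_dir_prim_lim.
move=> Q [eps hQ].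
apply: (Filter_prod _ _ _ (fun x => x = 1/2) (fun b =>
  ball (real_dir_prim N u (1/2)) eps (real_dir_prim N u (1/2) - real_dir_prim N u b) /\
  ball (real_dir_prim N v (1/2)) eps (real_dir_prim N v (1/2) - real_dir_prim N v b))) => //.
  apply: filter_and.
    exact: (proj1 (filterlim_locally _ _) (lu u) eps).
  exact: (proj1 (filterlim_locally _ _) (lu v) eps).
move=> x b -> [h1 h2] /=.
exists (real_dir_prim N u (1/2) - real_dir_prim N u b,
        real_dir_prim N v (1/2) - real_dir_prim N v b); split; last exact: hQ.
apply: is_RInt_fct_extend_pair.
  apply: is_RInt_ext (is_RInt_real_dir N u _ _) => y _.
  by rewrite dir_poly_sub_coef.
apply: is_RInt_ext (is_RInt_real_dir N v _ _) => y _.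
by rewrite dir_poly_sub_coef.
Qed.

Lemma Re_mul_sum (l : seq nat) c (a : nat -> C) (f : nat -> R) :
  Re c * \sum_(n <- l) (Re (a n) * f n) - Im c * \sum_(n <- l) (Im (a n) * f n) =
  \sum_(n <- l) (Re (c * a n)%C * f n).
Proof.
elim: l => [|n l]; first by rewrite !big_nil /Re /=; ring.
by rewrite !big_cons => <-; rewrite /Re /Im /=; ring.
Qed.

Lemma exponent_exists p : 1 < p -> exists2 m, (0 < m)%N & 1 <= (p - 1) * (INR (2 * m) - 1).
Proof.
move=> p1; have [n hn] := INR_unbounded (1 / (p - 1) + 1).
exists n.+1 => //; have -> : INR (2 * n.+1) = 2 * INR n.+1 by rewrite -multE mult_INR.
have n0 := pos_INR n; rewrite S_INR.
have : 1 / (p - 1) <= 2 * (INR n + 1) - 1 by lra.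
by move=> /Rle_div_l; lra.
Qed.

Theorem theorem6p1 (p : R) (hp : 1 < p) :
  exists Cp : R, forall (N : nat) (a : nat -> C),
    exists L : C,
      is_RInt_gen (fun x : R => Cminus (dir_poly N a (RtoC x)) (dir_coef N a 1%nat))
                  (at_point (1/2)) (Rbar_locally p_infty) L /\
      Cmod L <= Cp * Hp_norm p N a.
Proof.
have [m m0 hm] := exponent_exists p hp.
have [K K0 hK] := point_eval p m hp hm m0.
set d := / INR (2 * m) in hK.
have d0 : 0 < d by apply: Rinv_0_lt_compat; apply: INR_gt0; rewrite muln_gt0.
(* An antiderivative of the bound for |f(x) - a_1| / ||f||: the point evaluation bound integrates to
   a multiple of (x - 1/2)^d, finite at 1/2 because d > 0, and [3 * x] accounts for |a_1|. *)
pose E x := K * exp ((1 - d) * ln 2) / d * exp (d * ln (x - 1 / 2)) + 3 * x.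
(* The first term bounds the integral beyond 2, the second the integral from 1/2 to 2. *)
exists (6 / ln 2 + E 2) => N a; have X0 := Hp_norm_ge0 p N a.
set X := Hp_norm p N a in X0 *.
eexists; split; first exact: is_RInt_gen_dir_poly.
(* Rotating by the phase of [L] reduces the claim to the real coefficients [r n]. *)
set L := (_, _); have [c c1 hc] := unimodular_phase L.
pose r n := Re (c * a n)%C.
have cf n : (0 < n <= N)%N -> Cmod (a n) <= 3 * X by move=> hn; exact: (coef_bound p m).
have Re_le z : Rabs (Re (c * z)%C) <= Cmod z.
  apply: Rle_trans (Rle_trans _ _ _ (Rmax_l _ _) (Rmax_Cmod _)) _.
  by rewrite Cmod_mult -[X in _ <= X]Rmult_1_l; apply: Rmult_le_compat_r => //; exact: Cmod_ge_0.
have psiL : real_dir_prim N r (1/2) = Cmod L.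
  by rewrite -hc; exact: esym (Re_mul_sum _ c a _).
have psi' x : 1 / 2 < x <= 2 ->
    real_dir N r x <= (K * exp ((1 - d) * ln (2 / (x - 1 / 2))) + 3) * X.
  move=> hx.
  have -> : real_dir N r x = Re (c * Cminus (dir_poly N a (RtoC x)) (dir_coef N a 1%N))%C.
    by rewrite dir_poly_sub_coef; exact: esym (Re_mul_sum _ c a _).
  apply: Rle_trans (Rle_abs _) _; apply: Rle_trans (Re_le _) _.
  apply: Rle_trans (Cmod_triangle _ _) _; rewrite Cmod_opp Rmult_plus_distr_r.
  apply: Rplus_le_compat; first exact: hK.
  by rewrite /dir_coef; case: (N) cf => [|n] h /=; [rewrite Cmod_0; lra|exact: h].
(* Here |r n| <= 3 X, ln n >= ln 2, and the sum of n^(-2) is at most 2. *)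
have psi2 : real_dir_prim N r 2 <= 6 / ln 2 * X.
  have l2 := ln_lt_2.
  apply: (Rle_trans _ (\sum_(n <- iota 2 N.-1) (3 * X / ln 2 * nexp 2 n))).
    apply: sum_le => n; rewrite mem_iota => /andP [n2 nN].
    have hn : (0 < n <= N)%N.
      by rewrite (ltnW n2) /=; case: (N) nN => [|k]; rewrite ?addn0 ?add2n ?ltnS //= leqNgt n2.
    have rn : r n <= 3 * X by apply: Rle_trans (Rle_abs _) _; apply: Rle_trans (Re_le _) (cf _ hn).
    have ln2 := ln_INR_ge_ln2 n n2; have P := nexp_gt0 2 n.
    have -> : r n * (nexp 2 n / ln (INR n)) = r n * / ln (INR n) * nexp 2 n by rewrite /Rdiv; ring.
    apply: Rmult_le_compat_r; first lra.
    apply: (Rle_trans _ (3 * X * / ln (INR n))).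
      by apply: Rmult_le_compat_r => //; apply: Rlt_le; apply: Rinv_0_lt_compat; lra.
    by apply: Rmult_le_compat_l; [lra|apply: Rinv_le_contravar; lra].
  rewrite -big_distrr /=.
  have -> : 6 / ln 2 * X = 3 * X / ln 2 * 2 by field; lra.
  apply: Rmult_le_compat_l.
    by apply: Rmult_le_pos; [lra|apply: Rlt_le; apply: Rinv_0_lt_compat; lra].
  apply: (Rle_trans _ (1 + / (2 - 1))); last by apply: Req_le; field.
  apply: Rle_trans (zeta_partial_le 2 N _); last lra.
  apply: sum_uniq_le; first exact: iota_uniq.
    move=> n; rewrite mem_iota => /andP [n2 nN]; rewrite (ltnW n2) /=.
    by case: (N) nN => [|k]; rewrite ?addn0 ?add2n ?ltnS //= leqNgt n2.
  by move=> n; apply: Rlt_le; exact: nexp_gt0.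
have E' x : 1 / 2 < x -> is_derive E x (K * exp ((1 - d) * ln (2 / (x - 1 / 2))) + 3).
  move=> hx; rewrite /E; auto_derive; first lra.
  rewrite ln_div; [|lra|lra].
  have -> : exp (d * ln (x - 1 / 2)) = exp (- ((1 - d) * ln (x - 1 / 2))) * (x - 1 / 2).
    by rewrite -[X in _ = _ * X]exp_ln; [rewrite -exp_plus; congr exp; ring|lra].
  have -> : (1 - d) * (ln 2 - ln (x - 1 / 2)) = (1 - d) * ln 2 + - ((1 - d) * ln (x - 1 / 2)) by ring.
  by rewrite exp_plus; field; lra.
have mono x : 1 / 2 < x <= 2 -> real_dir_prim N r x <= (6 / ln 2 + E 2) * X.
  move=> hx.
  (* The function [real_dir_prim N r + E * X] has nonnegative derivative on (1/2, 2], so it is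
     nondecreasing there. *)
  have H : real_dir_prim N r x + E x * X <= real_dir_prim N r 2 + E 2 * X.
    pose f y := real_dir_prim N r y + E y * X.
    pose df y := - real_dir N r y + (K * exp ((1 - d) * ln (2 / (y - 1 / 2))) + 3) * X.
    have fd y : 1 / 2 < y -> is_derive f y (df y).
      move=> hy; apply: (is_derive_plus (real_dir_prim N r)); first exact: real_dir_prim_derive.
      by apply: (is_derive_scal_l E); exact: E'.
    have mm : Rmin x 2 = x /\ Rmax x 2 = 2 by rewrite Rmin_left ?Rmax_right; lra.
    have [y hy|y hy|y [hy fy]] := MVT_gen f x 2 df; rewrite ?(proj1 mm) ?(proj2 mm) in hy.
    - by apply: fd; lra.
    - by apply/continuity_pt_filterlim; apply: ex_derive_continuous; exists (df y); apply: fd; lra.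
    - have : 0 <= df y by rewrite /df; have := psi' y ltac:(lra); lra.
      move: fy; rewrite /f => fy d1; have : 0 <= df y * (2 - x) by apply: Rmult_le_pos; lra.
      lra.
  have E0 : 0 <= E x.
    rewrite /E; have : 0 <= K * exp ((1 - d) * ln 2) / d * exp (d * ln (x - 1 / 2)); last lra.
    apply: Rmult_le_pos; last by apply: Rlt_le; exact: exp_pos.
    apply: Rmult_le_pos; last by apply: Rlt_le; exact: Rinv_0_lt_compat.
    by apply: Rmult_le_pos => //; apply: Rlt_le; exact: exp_pos.
  have := Rmult_le_pos _ _ E0 X0; lra.
(* The derivative of [E] is controlled only to the right of 1/2, so [mono] stops short of the
   endpoint; continuity of the primitive carries the bound to 1/2. *)
rewrite -psiL; apply: Rnot_lt_le => contra.
have cont : continuous (real_dir_prim N r) (1/2).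
  by apply: ex_derive_continuous; eexists; exact: real_dir_prim_derive.
have [eps heps] := cont _ (open_gt ((6 / ln 2 + E 2) * X) _ contra).
pose x := 1 / 2 + Rmin (eps / 2) 1.
have e0 := cond_pos eps.
have hx : 1 / 2 < x <= 2.
  rewrite /x; have := Rmin_r (eps / 2) 1.
  have : 0 < Rmin (eps / 2) 1 by apply: Rmin_pos; lra.
  lra.
have bx : ball (1/2) eps x.
  rewrite /ball /= /AbsRing_ball /abs /minus /plus /opp /= /x.
  have -> : 1 / 2 + Rmin (eps / 2) 1 + - (1 / 2) = Rmin (eps / 2) 1 by ring.
  have := Rmin_l (eps / 2) 1.
  have : 0 < Rmin (eps / 2) 1 by apply: Rmin_pos; lra.
  by move=> h1 h2; rewrite Rabs_pos_eq; lra.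
have := heps x bx; have := mono x hx; lra.
Qed.
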